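(* Let $\kappa$ be a cardinal and $n<\omega$. Suppose that $\lim^s\mathbf{A}_\kappa=0$ for all $1\leq s\leq n+1$. Then whenever $\mathcal{G}$ is an $\Omega_\kappa$ system with each group $G_{\alpha,k}$ finitely generated, the canonical map \[\bigoplus_{\alpha<\kappa}\lim\nolimits^n\,\mathbf{G}_\alpha\to\lim\nolimits^n\,\mathbf{G}\] is an isomorphism.
   Context: All groups are abelian; $\lim^n$ denotes the $n$-th right derived functor of the inverse limit functor on inverse systems of abelian groups indexed by a directed poset. The set $\omega^\kappa$ of functions $\kappa\to\omega$ is ordered pointwise ($x\leq y$ iff $x(\alpha)\leq y(\alpha)$ for all $\alpha<\kappa$). An $\Omega_\kappa$ system $\mathcal{G}$ consists of abelian groups $G_{\alpha,k}$ ($\alpha<\kappa$, $k<\omega$) and, for $j\geq k$, homomorphisms $p_{\alpha,j,k}\colon G_{\alpha,j}\to G_{\alpha,k}$ which are compatible ($p_{\alpha,k,k}=\mathrm{id}$ and $p_{\alpha,j,k}\circ p_{\alpha,l,j}=p_{\alpha,l,k}$). From it one obtains: the inverse system $\mathbf{G}$ indexed by $\omega^\kappa$ with $\mathbf{G}_x=G_x:=\bigoplus_{\alpha<\kappa}G_{\alpha,x(\alpha)}$ and, for $x\leq y$, bonding maps $p_{y,x}=\bigoplus_{\alpha<\kappa}p_{\alpha,y(\alpha),x(\alpha)}\colon G_y\to G_x$; and for each $\alpha<\kappa$ the inverse system $\mathbf{G}_\alpha$ indexed by $\omega$ with $(\mathbf{G}_\alpha)_k=G_{\alpha,k}$ and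 bonding maps $p_{\alpha,j,k}$. Canonical map: for $\alpha<\kappa$, pulling back along evaluation $\omega^\kappa\to\omega$, $x\mapsto x(\alpha)$, turns $\mathbf{G}_\alpha$ into the system $x\mapsto G_{\alpha,x(\alpha)}$ over $\omega^\kappa$, and this pullback induces an isomorphism of derived limits $\lim^n\mathbf{G}_\alpha\cong\lim^n(\text{pullback})$. The inclusion of this pulled-back system into $\mathbf{G}$ as the $\alpha$-th summand induces a map $\lim^n\mathbf{G}_\alpha\to\lim^n\mathbf{G}$; summing over $\alpha$ gives the canonical map $\bigoplus_{\alpha<\kappa}\lim^n\mathbf{G}_\alpha\to\lim^n\mathbf{G}$. $\mathcal{A}_\kappa$ is the $\Omega_\kappa$ system with $G_{\alpha,k}=\mathbb{Z}^k$ for all $\alpha,k$ and bonding maps the canonical projections $\mathbb{Z}^j\to\mathbb{Z}^k$ onto the first $k$ coordinates; $\mathbf{A}_\kappa$ is the associated inverse system indexed by $\omega^\kappa$, so $(\mathbf{A}_\kappa)_x=\bigoplus_{\alpha<\kappa}\mathbb{Z}^{x(\alpha)}$. *)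

(* Defs.v *)
From HB Require Import structures.
From mathcomp Require Import all_boot all_order all_algebra generic_quotient ring_quotient.
From mathcomp Require Import mathcomp_extra boolp classical_sets functions.
From mathcomp Require Import cardinality fsbigop.

Set Implicit Arguments.
Unset Strict Implicit.
Unset Printing Implicit Defensive.

Import Order.TTheory GRing.Theory Num.Theory.

Local Open Scope ring_scope.
Local Open Scope classical_set_scope.
Local Open Scope quotient_scope.

Section MakeAdditive.
Variables (U V : zmodType) (f : U -> V) (fB : {morph f : x y / x - y}).

Definition mkadd : {additive U -> V} :=
  HB.pack f (GRing.isZmodMorphism.Build U V f fB).

Lemma mkaddE x : mkadd x = f x. Proof. by []. Qed.
End MakeAdditive.

Section Subgroup.
Variable V : zmodType.

Section Make.
Variables (P : V -> Prop) (P0 : P 0) (PB : forall x y, P x -> P y -> P (x - y)).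

Definition psub : pred V := fun x => `[< P x >].

Lemma psub_closed : zmod_closed psub.
Proof.
split; first exact/asboolP.
by move=> x y /asboolP Px /asboolP Py; apply/asboolP/PB.
Qed.

Definition mksub : zmodClosed V :=
  HB.pack psub (GRing.isZmodClosed.Build V psub psub_closed).

Lemma mksubP x : x \in mksub <-> P x.
Proof. by split=> [/asboolP|Px]; last exact/asboolP. Qed.
End Make.

Variable S : zmodClosed V.

Definition subgrp := {x : V | x \in (S : {pred V})}.
HB.instance Definition _ := SubChoice.on subgrp.
HB.instance Definition _ := [SubChoice_isSubZmodule of subgrp by <:].

Definition sgval : {additive subgrp -> V} := mkadd (raddfB val).

Lemma sgvalE (u : subgrp) : sgval u = val u. Proof. by []. Qed.

Lemma sgval_inj : injective sgval. Proof. exact: val_inj. Qed.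

Definition sgproj (x : V) (xS : x \in (S : {pred V})) : subgrp := Sub x xS.

Lemma sgprojK x (xS : x \in (S : {pred V})) : val (sgproj xS) = x.
Proof. by []. Qed.

Definition quotg : zmodType := Quotient.quot S.

Definition quotpi_fun (x : V) : quotg := \pi_(Quotient.quot S) x.

Lemma quotpi_morph : {morph quotpi_fun : x y / x - y}.
Proof. by move=> x y; rewrite /quotpi_fun !piE. Qed.

Definition quotpi : {additive V -> quotg} := mkadd quotpi_morph.

Lemma quotpi_eq0 x : quotpi x = 0 <-> x \in (S : {pred V}).
Proof.
rewrite -{2}[x]subr0 Quotient.idealrBE; split=> [h|/eqP h].
  apply/eqP; transitivity (quotpi x); first by [].
  by rewrite h -[LHS](raddf0 quotpi).
by transitivity (quotpi 0); [exact: h|rewrite raddf0].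
Qed.

Lemma quotpi_reprK q : quotpi (repr (q : Quotient.quot S)) = q.
Proof. exact: reprK. Qed.
End Subgroup.

Section QuotientLift.
Variables (V W : zmodType) (S : zmodClosed V) (f : {additive V -> W}).
Hypothesis fS : forall x, x \in (S : {pred V}) -> f x = 0.

Definition quotlift_fun (q : quotg S) : W := f (repr (q : Quotient.quot S)).

Lemma quotlift_funE x : quotlift_fun (quotpi S x) = f x.
Proof.
apply/eqP; rewrite -subr_eq0 -raddfB; apply/eqP/fS/quotpi_eq0.
by rewrite raddfB; apply/eqP; rewrite subr_eq0 quotpi_reprK.
Qed.

Lemma quotlift_morph : {morph quotlift_fun : x y / x - y}.
Proof.
move=> x y; rewrite -[x]quotpi_reprK -[y]quotpi_reprK -raddfB.
by rewrite !quotlift_funE raddfB.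
Qed.

Definition quotlift : {additive quotg S -> W} := mkadd quotlift_morph.

Lemma quotliftE x : quotlift (quotpi S x) = f x.
Proof. exact: quotlift_funE. Qed.
End QuotientLift.

Section KernelImage.
Variables (V W : zmodType) (f : {additive V -> W}).

Lemma kerg_subproof x y : f x = 0 -> f y = 0 -> f (x - y) = 0.
Proof. by move=> fx fy; rewrite raddfB fx fy subr0. Qed.

Definition kerg : zmodClosed V := mksub (raddf0 f) kerg_subproof.

Lemma kergP x : x \in kerg <-> f x = 0. Proof. exact: mksubP. Qed.

Lemma img_subproof0 : exists x, 0 = f x.
Proof. by exists 0; rewrite raddf0. Qed.

Lemma img_subproofB y z :
  (exists x, y = f x) -> (exists x, z = f x) -> exists x, y - z = f x.
Proof. by move=> [a ->] [b ->]; exists (a - b); rewrite raddfB. Qed.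

Definition img : zmodClosed W := mksub img_subproof0 img_subproofB.

Lemma imgP y : y \in img <-> exists x, y = f x. Proof. exact: mksubP. Qed.
End KernelImage.

Section Product.
Variables (I : Type) (A : I -> zmodType).

Definition gprod := forall i, A i.
HB.instance Definition _ := Choice.copy gprod (forall i, A i).

Definition gprod_zero : gprod := fun i => 0.
Definition gprod_opp (f : gprod) : gprod := fun i => - f i.
Definition gprod_add (f g : gprod) : gprod := fun i => f i + g i.

Lemma gprod_addA : associative gprod_add.
Proof. by move=> f g h; apply: functional_extensionality_dep => i; apply: addrA. Qed.
Lemma gprod_addC : commutative gprod_add.
Proof. by move=> f g; apply: functional_extensionality_dep => i; apply: addrC. Qed.
Lemma gprod_add0 : left_id gprod_zero gprod_add.
Proof. by move=> f; apply: functional_extensionality_dep => i; apply: add0r. Qed.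
Lemma gprod_addN : left_inverse gprod_zero gprod_opp gprod_add.
Proof. by move=> f; apply: functional_extensionality_dep => i; apply: addNr. Qed.

HB.instance Definition _ :=
  GRing.isZmodule.Build gprod gprod_addA gprod_addC gprod_add0 gprod_addN.

Lemma gprodP (f g : gprod) : (forall i, f i = g i) -> f = g.
Proof. exact: functional_extensionality_dep. Qed.

Lemma gprodB (f g : gprod) i : (f - g) i = f i - g i. Proof. by []. Qed.
Lemma gprodD (f g : gprod) i : (f + g) i = f i + g i. Proof. by []. Qed.
Lemma gprod0 i : (0 : gprod) i = 0. Proof. by []. Qed.
End Product.

Section DirectSum.
Variables (I : choiceType) (A : I -> zmodType).

Definition finsupp_prop (f : gprod A) := finite_set [set i | f i <> 0].

Lemma finsupp0 : finsupp_prop 0.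
Proof.
rewrite /finsupp_prop (_ : mkset _ = set0) ?finite_set0//.
by apply/seteqP; split=> i //=; apply.
Qed.

Lemma finsuppB f g : finsupp_prop f -> finsupp_prop g -> finsupp_prop (f - g).
Proof.
move=> ff fg; apply: (@sub_finite_set _ _ ([set i | f i <> 0] `|` [set i | g i <> 0])).
  move=> i /= fgi; case: (pselect (f i = 0)) => fi; last by left.
  by right=> gi; apply: fgi; rewrite gprodB fi gi subr0.
by rewrite finite_setU.
Qed.

Definition finsupp : zmodClosed (gprod A) := mksub finsupp0 finsuppB.

Definition gsum : zmodType := subgrp finsupp.

Lemma gsumP (f g : gsum) : (forall i, val f i = val g i) -> f = g.
Proof. by move=> fg; apply/val_inj/gprodP. Qed.

Lemma gsumB (f g : gsum) i : val (f - g) i = val f i - val g i.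
Proof. by []. Qed.

Lemma gsum_finite (f : gsum) : finite_set [set i | val f i <> 0].
Proof. exact: (mksubP finsupp0 finsuppB _).1 (valP f). Qed.

Lemma dfwith_finsupp i (a : A i) :
  finsupp_prop (eqtype.dfwith (fun j => 0 : A j) a : gprod A).
Proof.
apply: (@sub_finite_set _ _ [set i]); last exact: finite_set1.
by move=> j /=; case: eqtype.dfwithP.
Qed.

Definition gsum_in_fun i (a : A i) : gsum :=
  sgproj ((mksubP finsupp0 finsuppB _).2 (dfwith_finsupp a)).

Lemma gsum_in_morph i : {morph @gsum_in_fun i : a b / a - b}.
Proof.
move=> a b; apply: gsumP => j /=; rewrite gprodB.
case: (eqVneq i j) => [<-|ij]; first by rewrite /= !eqtype.dfwith_in.
by rewrite /= !eqtype.dfwith_out// subr0.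
Qed.

Definition gsum_in i : {additive A i -> gsum} := mkadd (@gsum_in_morph i).
End DirectSum.

Section DirectSumMap.
Variables (I : choiceType) (A B : I -> zmodType).
Variable f : forall i, {additive A i -> B i}.

Lemma gsum_map_subproof (s : gsum A) :
  finsupp_prop ((fun i => f i (val s i)) : gprod B).
Proof.
apply: sub_finite_set (gsum_finite s) => i /= fi si.
by apply: fi; rewrite si raddf0.
Qed.

Definition gsum_map_fun (s : gsum A) : gsum B :=
  sgproj ((mksubP (@finsupp0 _ B) (@finsuppB _ B) _).2 (gsum_map_subproof s)).

Lemma gsum_map_morph : {morph gsum_map_fun : s t / s - t}.
Proof. by move=> s t; apply: gsumP => i; rewrite /= !gprodB /= raddfB. Qed.

Definition gsum_map : {additive gsum A -> gsum B} := mkadd gsum_map_morph.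
End DirectSumMap.

Section DirectSumOut.
Variables (I : choiceType) (A : I -> zmodType) (B : zmodType).
Variable f : forall i, {additive A i -> B}.

(* Only the finitely many nonzero terms contribute to this sum. *)
Definition gsum_out_fun (s : gsum A) : B := \sum_(i \in [set: I]) f i (val s i).

Lemma gsum_outE (s : gsum A) (r : seq I) : uniq r ->
  (forall i, val s i <> 0 -> i \in r) ->
  gsum_out_fun s = \sum_(i <- r) f i (val s i).
Proof.
move=> ur sr; rewrite /gsum_out_fun (fsbigE r)//.
  by apply: eq_bigl => i; rewrite in_setT.
move=> i _ /negP ir; case: (pselect (val s i = 0)) => [->|/sr//].
by rewrite raddf0.
Qed.

Lemma gsum_out_morph : {morph gsum_out_fun : s t / s - t}.
Proof.
move=> s t; pose D := [set i | val s i <> 0] `|` [set i | val t i <> 0].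
have finD : finite_set D by rewrite finite_setU; split; apply: gsum_finite.
have [r ur inr] : exists2 r : seq I, uniq r & forall i, D i -> i \in r.
  have /finite_seqP[r Dr] := finD.
  by exists (undup r) => [|i]; rewrite ?undup_uniq// mem_undup Dr.
rewrite (@gsum_outE s r)//; last by move=> i si; apply: inr; left.
rewrite (@gsum_outE t r)//; last by move=> i ti; apply: inr; right.
rewrite (@gsum_outE (s - t) r)//; last first.
  move=> i sti; apply: inr; case: (pselect (val s i = 0)) => si; last by left.
  by right=> ti; apply: sti; rewrite gsumB si ti subr0.
by rewrite -sumrB; apply: eq_bigr => i _; rewrite gsumB raddfB.
Qed.

Definition gsum_out : {additive gsum A -> B} := mkadd gsum_out_morph.
End DirectSumOut.

Definition fin_gen (A : zmodType) :=
  exists (m : nat) (v : 'I_m -> A),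
    forall a, exists c : 'I_m -> int, a = \sum_(i < m) v i *~ c i.

Definition injective_group (J : zmodType) :=
  forall (A B : zmodType) (i : {additive A -> B}) (f : {additive A -> J}),
    injective i -> exists g : {additive B -> J}, forall a, g (i a) = f a.

Definition divisible (J : zmodType) :=
  forall (n : nat) (x : J), (0 < n)%N -> exists y, y *+ n = x.

Section ExtendHom.
Variables (B J : zmodType) (divJ : divisible J).

Definition hom_graph (S : set (B * J)) :=
  [/\ S (0, 0), forall p q, S p -> S q -> S (p - q)
    & forall j, S (0, j) -> j = 0].

Lemma hom_graphN S p : hom_graph S -> S p -> S (- p).
Proof. by move=> [S0 SB _] Sp; rewrite -[- p]add0r; apply: SB. Qed.

Lemma hom_graphD S p q : hom_graph S -> S p -> S q -> S (p + q).
Proof.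
move=> hS Sp Sq; rewrite -[q]opprK; case: (hS) => _ SB _.
by apply: SB => //; apply: hom_graphN.
Qed.

Lemma hom_graphN2 S b j : hom_graph S -> S (b, j) -> S (- b, - j).
Proof. exact: hom_graphN. Qed.

Lemma hom_graphB2 S b j c k :
  hom_graph S -> S (b, j) -> S (c, k) -> S (b - c, j - k).
Proof. by move=> [_ SB _]; apply: SB. Qed.

Lemma hom_graphMz S p (m : int) : hom_graph S -> S p -> S (p *~ m).
Proof.
move=> hS Sp; have Sn (n : nat) : S (p *+ n).
  elim: n => [|n IH]; first by case: hS; rewrite mulr0n.
  by rewrite mulrS; apply: hom_graphD.
case: m => n; first exact: Sn.
by rewrite NegzE mulrNz; apply: hom_graphN => //; exact: Sn.
Qed.

Lemma hom_graph_fun S b j k : hom_graph S -> S (b, j) -> S (b, k) -> j = k.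
Proof.
move=> [_ SB S0] Sj Sk; apply/eqP; rewrite -subr_eq0; apply/eqP/S0.
by rewrite -(subrr b); apply: (SB _ _ Sj Sk).
Qed.

Lemma pairMz (p : B * J) (m : int) : p *~ m = (p.1 *~ m, p.2 *~ m).
Proof.
have pn (n : nat) : p *+ n = (p.1 *+ n, p.2 *+ n).
  by elim: n => [|n IH]; rewrite ?mulr0n// !mulrS IH; case: p {IH}.
by case: m => n; rewrite ?NegzE ?mulrNz -?pmulrn ?pn.
Qed.

Lemma hom_graph_slope S b : hom_graph S ->
  exists j, forall (m : int) c, S (b *~ m, c) -> c = j *~ m.
Proof.
move=> hS; pose T := fun n : nat => (0 < n)%N && `[< exists c, S (b *+ n, c) >].
case: (pselect (exists n, T n)) => [exT|nT]; last first.
  exists 0 => m c Sc; have [m0|m0] := eqVneq m 0.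
    by move: Sc; rewrite m0 !mulr0z; case: hS => _ _; apply.
  case: nT; exists `|m|%N; rewrite /T absz_gt0 m0; apply/asboolP.
  case: m Sc {m0} => n Sc; first by exists c.
  exists (- c); have := hom_graphN2 hS Sc.
  by rewrite NegzE mulrNz opprK.
case: (ex_minnP exT) => n /andP[n0 /asboolP[a Sa]] nmin.
have [j ja] := divJ a n0; exists j => m c Sc.
pose q := (m %/ n%:Z)%Z; pose r := (m %% n%:Z)%Z.
have mE : m = q * n%:Z + r by exact: divz_eq.
have Sqn : S (b *~ (q * n%:Z), a *~ q).
  have := hom_graphMz q hS Sa; rewrite pairMz /=.
  by rewrite [q * _]mulrC mulrzA.
have r0 : r = 0.
  have rge0 : (0 <= r)%R by apply: modz_ge0; rewrite eqz_nat -lt0n.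
  have rlt : (r < n%:Z)%R by apply: ltz_pmod; rewrite ltz_nat.
  case: r mE rge0 rlt => // r mE _; rewrite ltz_nat => rn.
  case: (posnP r) => [-> //|rgt0].
  suff /nmin : T r by rewrite leqNgt rn.
  rewrite /T rgt0; apply/asboolP; exists (c - a *~ q).
  have := hom_graphB2 hS Sc Sqn.
  by rewrite mE mulrzDr [b *~ _ + _]addrC addrK.
have mqn : m = q * n%:Z by rewrite mE r0 addr0.
rewrite (hom_graph_fun hS Sc (k := a *~ q)); last by rewrite mqn.
by rewrite mqn [q * _]mulrC mulrzA -ja.
Qed.

Lemma extend_hom_graph S0 : hom_graph S0 ->
  exists f : {additive B -> J}, forall b j, S0 (b, j) -> f b = j.
Proof.
move=> hS0; pose P := fun S => S = set0 \/ (S0 `<=` S /\ hom_graph S).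
have [|A [PA maxA]] := @Zorn_bigcup (B * J)%type P.
  move=> F FP Ftot; case: (pselect (exists2 S, F S & S !=set0)); last first.
    move=> nF; left; apply/seteqP; split=> // p [S FS Sp]; apply: nF.
    by exists S => //; exists p.
  move=> [S FS [p Sp]]; right.
  have good T p' : F T -> T p' -> S0 `<=` T /\ hom_graph T.
    by move=> FT Tp; case: (FP _ FT) => // T0; rewrite T0 in Tp.
  have [S0S hS] := good _ _ FS Sp; split.
    by move=> x /S0S Sx; exists S.
  split; first by case: hS => S00 _ _; exists S.
    move=> x y [T FT Tx] [U FU Uy].
    have [TU|UT] := Ftot _ _ FT FU.
      have [_ [_ UB _]] := good _ _ FU Uy.
      by exists U => //; apply: UB => //; apply: TU.
    have [_ [_ TB _]] := good _ _ FT Tx.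
    by exists T => //; apply: TB => //; apply: UT.
  move=> j [T FT Tj]; have [_ [_ _ T0]] := good _ _ FT Tj.
  exact: T0.
have {PA}[S0A hA] : S0 `<=` A /\ hom_graph A.
  case: PA => // A0; case: (maxA S0); last by right; split=> [p|].
  rewrite A0; split=> // S0e; case: hS0 => S00 _ _.
  by have := S0e _ S00.
have totA b : exists j, A (b, j).
  apply: contrapT => nb.
  have [j jP] := hom_graph_slope b hA.
  pose A' := [set p | exists u m, A u /\ p = u + (b, j) *~ m] : set (B * J).
  have AA' : A `<=` A' by move=> p Ap; exists p, 0; rewrite mulr0z addr0.
  case: (maxA A').
    split=> // A'A; apply: nb; exists j; apply: A'A.
    by exists 0, 1; rewrite add0r mulr1z; split=> //; case: hA.
  right; split; first exact: subset_trans S0A AA'.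
  split; first by apply: AA'; case: hA.
    move=> _ _ [u [m [Au ->]]] [v [k [Av ->]]]; exists (u - v), (m - k).
    split; first by case: hA => _ AB _; apply: AB.
    by rewrite mulrzBr opprD addrACA.
  move=> c [[u v] [m [Auv]]]; rewrite pairMz => -[/esym ubm ->].
  have : A (b *~ m, - v).
    have := hom_graphN2 hA Auv.
    by move/eqP: ubm; rewrite addrC addr_eq0 => /eqP->.
  by move/jP => <-; rewrite subrr.
pose f b := sval (cid (totA b)).
have fA b : A (b, f b) by rewrite /f; case: cid.
have fB : {morph f : x y / x - y}.
  move=> x y; apply: (hom_graph_fun hA (fA _)).
  by case: hA => _ AB _; apply: AB (fA x) (fA y).
exists (mkadd fB) => b j /S0A Abj; exact: hom_graph_fun hA (fA b) Abj.
Qed.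
End ExtendHom.

Lemma divisible_injective (J : zmodType) : divisible J -> injective_group J.
Proof.
move=> divJ A B i f i_inj.
pose S : set (B * J) := [set p | exists a, p = (i a, f a)].
have hS : hom_graph S.
  split; first by exists 0; rewrite !raddf0.
    by move=> _ _ [a ->] [b ->]; exists (a - b); rewrite !raddfB.
  by move=> j [a [/esym ia ->]]; rewrite (i_inj a 0) ?raddf0// ia raddf0.
have [g gS] := extend_hom_graph divJ hS.
by exists g => a; apply: gS; exists a.
Qed.

Definition intrat_morph : {morph (fun z : int => z%:~R : rat) : x y / x - y} :=
  fun x y => mulrzBr 1 x y.

Definition QZ : zmodType := quotg (img (mkadd intrat_morph)).

Lemma QZ_divisible : divisible QZ.
Proof.
move=> n x n0; pose r : rat := repr (x : Quotient.quot _).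
exists (quotpi _ (r / n%:R)); rewrite -raddfMn/= -[_ *+ n]mulr_natr divfK.
  exact: quotpi_reprK.
by rewrite pnatr_eq0 -lt0n.
Qed.

Lemma QZ_separates (A : zmodType) (a : A) : a != 0 ->
  exists chi : {additive A -> QZ}, chi a <> 0.
Proof.
move=> a0.
have [n n1 an] : exists2 n : nat, (1 < n)%N &
    forall m : int, a *~ m = 0 -> exists q, m = q * n%:Z.
  pose T := fun n : nat => (0 < n)%N && (a *+ n == 0).
  case: (pselect (exists n, T n)) => [exT|nT]; last first.
    exists 2%N => // m am; exists 0; rewrite mul0r; apply: contrapT => /eqP m0.
    apply: nT; exists `|m|%N; rewrite /T absz_gt0 m0 /=.
    case: m am {m0} => n; first by move=> am; apply/eqP.
    by rewrite NegzE mulrNz => /eqP; rewrite oppr_eq0.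
  case: (ex_minnP exT) => n /andP[n0 /eqP an] nmin; exists n.
    by case: n n0 an {nmin} => [//|[|//]] _; rewrite mulr1n => /eqP; rewrite (negPf a0).
  move=> m am; exists (m %/ n%:Z)%Z; rewrite {1}(divz_eq m n%:Z).
  have rge0 : (0 <= (m %% n%:Z)%Z)%R by apply: modz_ge0; rewrite eqz_nat -lt0n.
  have rlt : ((m %% n%:Z)%Z < n%:Z)%R by apply: ltz_pmod; rewrite ltz_nat.
  have : a *~ (m %% n%:Z)%Z = 0.
    move: am; rewrite {1}(divz_eq m n%:Z) mulrzDr [_ * n%:Z]mulrC mulrzA.
    by rewrite -pmulrn an mul0rz add0r.
  case: (m %% n%:Z)%Z rge0 rlt => // r _; rewrite ltz_nat => rn ar.
  case: (posnP r) => [->|r0]; first by rewrite addr0.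
  by have := nmin r; rewrite /T r0 -pmulrn in ar * => /(_ (introT eqP ar)); rewrite leqNgt rn.
pose t : QZ := quotpi _ n%:R^-1.
have n0 : n%:R != 0 :> rat by rewrite pnatr_eq0 -lt0n ltnW.
have t0 : t <> 0.
  move/quotpi_eq0/imgP => [z]; rewrite mkaddE => /(congr1 (fun x => x * n%:R)).
  rewrite mulVf// pmulrn -intrM => /esym/eqP; rewrite -[1]/(1%:~R) eqr_int.
  move=> /eqP zn; have : (n %| 1)%N.
    by apply/dvdnP; exists `|z|%N; rewrite -[n]/(`|n%:Z|%N) -abszM zn.
  by rewrite dvdn1 => /eqP n1E; rewrite n1E in n1.
pose S : set (A * QZ) := [set p | exists m : int, p = (a *~ m, t *~ m)].
have hS : hom_graph S.
  split; first by exists 0; rewrite !mulr0z.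
    by move=> _ _ [m ->] [k ->]; exists (m - k); rewrite !mulrzBr.
  move=> j [m [/esym am ->]]; have [q ->] := an _ am.
  rewrite -raddfMz/=; apply/quotpi_eq0/imgP; exists q.
  by rewrite mkaddE -mulrzr intrM mulrC -mulrA -pmulrn divff// mulr1.
have [chi chiS] := extend_hom_graph QZ_divisible hS.
exists chi; rewrite (chiS a t)//.
by exists 1; rewrite !mulr1z.
Qed.

(* Every abelian group [A] embeds in the injective group (Q/Z)^Hom(A, Q/Z). *)
Definition injemb (A : zmodType) : zmodType :=
  gprod (fun _ : {additive A -> QZ} => QZ).

Section InjectiveEmbedding.
Variable A : zmodType.

Definition to_injemb_fun (a : A) : injemb A := fun chi => chi a.

Lemma to_injemb_morph : {morph to_injemb_fun : x y / x - y}.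
Proof. by move=> x y; apply: gprodP => chi; rewrite /to_injemb_fun raddfB. Qed.

Definition to_injemb : {additive A -> injemb A} := mkadd to_injemb_morph.

Lemma to_injemb_eq0 a : to_injemb a = 0 -> a = 0.
Proof.
move=> h; apply: contrapT => /eqP /QZ_separates[chi]; apply.
exact: (congr1 (fun f : injemb A => f chi) h).
Qed.
End InjectiveEmbedding.

Lemma injemb_injective (A : zmodType) : injective_group (injemb A).
Proof.
move=> B C i f i_inj.
have fB chi : {morph (fun b => f b chi) : x y / x - y}.
  by move=> x y; rewrite raddfB.
have /choice[g gP] chi : exists g : {additive C -> QZ}, forall b, g (i b) = f b chi.
  exact: (divisible_injective QZ_divisible (mkadd (fB chi)) i_inj).
have gB : {morph (fun c chi => g chi c) : x y / x - y >-> (x - y : injemb A)}.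
  by move=> x y; apply: gprodP => chi; rewrite gprodB raddfB.
by exists (mkadd gB) => b; apply: gprodP => chi; exact: gP.
Qed.

(* Systems are contravariant: for x <= y the bonding map goes from y to x. *)
Record invsys d (P : porderType d) := InvSys {
  isobj :> P -> zmodType;
  bond : forall x y, (x <= y)%O -> {additive isobj y -> isobj x};
  bond_id : forall x (h : (x <= x)%O) a, bond h a = a;
  bond_comp : forall x y z (hxy : (x <= y)%O) (hyz : (y <= z)%O)
    (hxz : (x <= z)%O) a, bond hxy (bond hyz a) = bond hxz a
}.

Record sysmor d (P : porderType d) (F G : invsys P) := SysMor {
  smor :> forall x, {additive F x -> G x};
  smor_nat : forall x y (h : (x <= y)%O) a,
    smor x (bond F h a) = bond G h (smor y a)
}.

Section Morphisms.
Variables (d : Order.disp_t) (P : porderType d).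
Implicit Types F G H : invsys P.

Definition sysmor_mono F G (f : sysmor F G) := forall x, injective (f x).

Definition sysid F : sysmor F F.
Proof. by exists (fun x => idfun : {additive F x -> F x}). Defined.

Definition syscomp F G H (g : sysmor G H) (f : sysmor F G) : sysmor F H.
Proof.
by exists (fun x => g x \o f x) => x y h a /=; rewrite !smor_nat.
Defined.

Lemma syscompE F G H (g : sysmor G H) (f : sysmor F G) x a :
  syscomp g f x a = g x (f x a).
Proof. by []. Qed.

Definition injective_sys (J : invsys P) :=
  forall (F G : invsys P) (i : sysmor F G) (f : sysmor F J), sysmor_mono i ->
    exists g : sysmor G J, forall x a, g x (i x a) = f x a.
End Morphisms.

Section Limit.
Variables (d : Order.disp_t) (P : porderType d).

Section Object.
Variable G : invsys P.

Definition thread_prop (t : gprod G) :=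
  forall x y (h : (x <= y)%O), bond G h (t y) = t x.

Lemma thread0 : thread_prop 0.
Proof. by move=> x y h; rewrite raddf0. Qed.

Lemma threadB s t : thread_prop s -> thread_prop t -> thread_prop (s - t).
Proof. by move=> sP tP x y h; rewrite !gprodB raddfB sP tP. Qed.

Definition threads : zmodClosed (gprod G) := mksub thread0 threadB.

Definition syslim : zmodType := subgrp threads.

Lemma syslimP (s t : syslim) : (forall x, val s x = val t x) -> s = t.
Proof. by move=> st; apply/val_inj/gprodP. Qed.

Lemma syslim_thread (t : syslim) : thread_prop (val t).
Proof. exact: (mksubP thread0 threadB _).1 (valP t). Qed.

Definition mkthread (t : gprod G) (tP : thread_prop t) : syslim :=
  sgproj ((mksubP thread0 threadB t).2 tP).
End Object.

Section Map.
Variables (F G : invsys P) (f : sysmor F G).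

Lemma syslim_map_subproof (t : syslim F) :
  thread_prop ((fun x => f x (val t x)) : gprod G).
Proof. by move=> x y h; rewrite -smor_nat syslim_thread. Qed.

Definition syslim_map_fun (t : syslim F) : syslim G :=
  mkthread (syslim_map_subproof t).

Lemma syslim_map_morph : {morph syslim_map_fun : s t / s - t}.
Proof. by move=> s t; apply: syslimP => x; rewrite /= !gprodB raddfB. Qed.

Definition syslim_map : {additive syslim F -> syslim G} := mkadd syslim_map_morph.

Lemma syslim_mapE t x : val (syslim_map t) x = f x (val t x).
Proof. by []. Qed.
End Map.
End Limit.

Record complex := Complex {
  cxobj :> nat -> zmodType;
  cxd : forall n, {additive cxobj n -> cxobj n.+1};
  cxdd : forall n a, cxd n.+1 (cxd n a) = 0
}.

Record cxmor (C D : complex) := CxMor {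
  cmor :> forall n, {additive C n -> D n};
  cmor_d : forall n a, cmor n.+1 (cxd C n a) = cxd D n (cmor n a)
}.

Section Cohomology.
Variable C : complex.

Definition cocycle n : zmodType := subgrp (kerg (cxd C n)).

Definition coboundary_prop n : C n -> Prop :=
  match n with
  | 0%N => fun a => a = 0
  | m.+1 => fun a => exists b, a = cxd C m b
  end.

Lemma coboundary0 n : coboundary_prop (val (0 : cocycle n)).
Proof. by case: n => [|n] //=; exists 0; rewrite raddf0. Qed.

Lemma coboundaryB n (a b : cocycle n) :
  coboundary_prop (val a) -> coboundary_prop (val b) ->
  coboundary_prop (val (a - b)).
Proof.
case: n a b => [|n] a b /=; first by move=> -> ->; rewrite subr0.
by move=> [u ->] [v ->]; exists (u - v); rewrite raddfB.
Qed.

Definition coboundary n : zmodClosed (cocycle n) :=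
  mksub (P := fun z : cocycle n => coboundary_prop (val z))
    (@coboundary0 n) (@coboundaryB n).

Definition cohomology n : zmodType := quotg (coboundary n).

Lemma cocycleP n (z : cocycle n) : cxd C n (val z) = 0.
Proof. by apply/kergP; apply: valP. Qed.
End Cohomology.

Lemma coboundary_map (C D : complex) (f : cxmor C D) n (a : C n) :
  coboundary_prop a -> coboundary_prop (f n a).
Proof.
case: n a => [|m] a /=; first by move=> ->; rewrite raddf0.
by move=> [b ->]; exists (f m b); rewrite cmor_d.
Qed.

Section CohomologyMap.
Variables (C D : complex) (f : cxmor C D) (n : nat).

Lemma cocycle_map_subproof (z : cocycle C n) : f n (val z) \in kerg (cxd D n).
Proof. by apply/kergP; rewrite -cmor_d cocycleP raddf0. Qed.

Definition cocycle_map_fun (z : cocycle C n) : cocycle D n :=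
  sgproj (cocycle_map_subproof z).

Lemma cocycle_map_morph : {morph cocycle_map_fun : x y / x - y}.
Proof. by move=> x y; apply: val_inj; rewrite /= raddfB. Qed.

Definition cocycle_map : {additive cocycle C n -> cocycle D n} :=
  mkadd cocycle_map_morph.

Lemma cohomology_map_subproof z : z \in coboundary C n ->
  (quotpi (coboundary D n) \o cocycle_map) z = 0.
Proof.
move=> /mksubP zb; apply/quotpi_eq0/mksubP.
exact: coboundary_map zb.
Qed.

Definition cohomology_map : {additive cohomology C n -> cohomology D n} :=
  quotlift cohomology_map_subproof.

Lemma cohomology_mapE z :
  cohomology_map (quotpi _ z) = quotpi _ (cocycle_map z).
Proof. exact: quotliftE. Qed.
End CohomologyMap.

Section Resolution.
Variables (d : Order.disp_t) (P : porderType d).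

Record resolution (G : invsys P) := Resolution {
  rsobj :> nat -> invsys P;
  rsaug : sysmor G (rsobj 0);
  rsd : forall n, sysmor (rsobj n) (rsobj n.+1);
  rs_mono : sysmor_mono rsaug;
  rs_exact0 : forall x a, rsd 0 x a = 0 <-> exists b, a = rsaug x b;
  rs_exactS : forall n x a, rsd n.+1 x a = 0 <-> exists b, a = rsd n x b
}.

Definition injective_resolution G (R : resolution G) :=
  forall n, injective_sys (R n).

Record resmor F G (f : sysmor F G) (R : resolution F) (S : resolution G) := ResMor {
  rmor :> forall n, sysmor (R n) (S n);
  rmor_aug : forall x a, rmor 0 x (rsaug R x a) = rsaug S x (f x a);
  rmor_d : forall n x a, rmor n.+1 x (rsd R n x a) = rsd S n x (rmor n x a)
}.

Lemma rsdd G (R : resolution G) n x a : rsd R n.+1 x (rsd R n x a) = 0.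
Proof. by apply/rs_exactS; exists a. Qed.

Section LimitComplex.
Variables (G : invsys P) (R : resolution G).

Lemma lim_complex_subproof n (t : syslim (R n)) :
  syslim_map (rsd R n.+1) (syslim_map (rsd R n) t) = 0.
Proof. by apply: syslimP => x; rewrite !syslim_mapE rsdd. Qed.

Definition lim_complex : complex := Complex lim_complex_subproof.
End LimitComplex.

Section LimitCxMor.
Variables (F G : invsys P) (f : sysmor F G).
Variables (R : resolution F) (S : resolution G) (phi : resmor f R S).

Lemma lim_cxmor_subproof n (t : lim_complex R n) :
  syslim_map (phi n.+1) (cxd (lim_complex R) n t) =
  cxd (lim_complex S) n (syslim_map (phi n) t).
Proof. by apply: syslimP => x; rewrite !syslim_mapE rmor_d. Qed.

Definition lim_cxmor : cxmor (lim_complex R) (lim_complex S) :=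
  @CxMor (lim_complex R) (lim_complex S) (fun n => syslim_map (phi n))
    lim_cxmor_subproof.
End LimitCxMor.
End Resolution.

(* Every system [G] embeds in the injective system
   x |-> prod_(z <= x) injemb (G z). *)
Section InjectiveEnvelope.
Variables (d : Order.disp_t) (P : porderType d) (G : invsys P).

Definition down (x : P) := {z : P | (z <= x)%O}.

Definition env_obj (x : P) : zmodType :=
  gprod (fun z : down x => injemb (G (sval z))).

Definition down_widen x y (h : (x <= y)%O) (z : down x) : down y :=
  exist _ (sval z) (le_trans (proj2_sig z) h).

Definition env_bond_fun x y (h : (x <= y)%O) (t : env_obj y) : env_obj x :=
  fun z => t (down_widen h z).

Lemma env_bond_morph x y (h : (x <= y)%O) :
  {morph env_bond_fun h : s t / s - t}.
Proof. by move=> s t; apply: gprodP. Qed.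

Definition env_bond x y (h : (x <= y)%O) : {additive env_obj y -> env_obj x} :=
  mkadd (env_bond_morph h).

Lemma env_eq x (t : env_obj x) (z : P) (h1 h2 : (z <= x)%O) :
  t (exist _ z h1) = t (exist _ z h2).
Proof. by rewrite (bool_irrelevance h1 h2). Qed.

Definition env : invsys P.
Proof.
exists env_obj env_bond.
  by move=> x h a; apply: gprodP => -[z zx]; rewrite /=; refine (@env_eq x a z _ _).
by move=> x y z hxy hyz hxz a; apply: gprodP => -[w wx]; rewrite /=; refine (@env_eq z a w _ _).
Defined.

Definition to_env_fun x (a : G x) : env x :=
  fun z => to_injemb (G (sval z)) (bond G (proj2_sig z) a).

Lemma to_env_morph x : {morph @to_env_fun x : a b / a - b}.
Proof. by move=> a b; apply: gprodP => z; rewrite gprodB /to_env_fun !raddfB. Qed.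

Definition to_env : sysmor G env.
Proof.
exists (fun x => mkadd (@to_env_morph x)) => x y h a.
apply: gprodP => -[z zx]; rewrite /= /to_env_fun /env_bond_fun /=.
by congr (to_injemb _ _); exact: bond_comp.
Defined.

Lemma to_env_mono : sysmor_mono to_env.
Proof.
move=> x a b ab; apply/eqP; rewrite -subr_eq0; apply/eqP.
have {}ab : to_env x (a - b) = 0 by rewrite raddfB ab subrr.
apply: to_injemb_eq0; rewrite -[a - b](bond_id (lexx x)).
exact: (congr1 (fun f : env_obj x => f (exist _ x (lexx x))) ab).
Qed.

Lemma env_injective : injective_sys env.
Proof.
move=> F H i f i_mono.
pose top z : down z := exist _ z (lexx z).
have fB z : {morph (fun a => (f z a : env_obj z) (top z)) : s t / s - t}.
  by move=> s t; rewrite raddfB.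
have ex z : exists h : {additive H z -> injemb (G z)},
    forall a, h (i z a) = (f z a : env_obj z) (top z).
  exact: (injemb_injective (mkadd (fB z)) (i_mono z)).
pose h z := sval (cid (ex z)).
have hi z a : h z (i z a) = (f z a : env_obj z) (top z).
  by rewrite /h; case: cid.
pose g_fun x (b : H x) : env_obj x := fun z => h (sval z) (bond H (proj2_sig z) b).
have gB x : {morph g_fun x : s t / s - t}.
  by move=> s t; apply: gprodP => z; rewrite gprodB /g_fun !raddfB.
have g_nat x y (hxy : (x <= y)%O) b :
    mkadd (gB x) (bond H hxy b) = bond env hxy (mkadd (gB y) b).
  apply: gprodP => -[z zx].
  rewrite /= /g_fun /env_bond_fun /=.
  by congr (h _ _); exact: bond_comp.
exists (@SysMor _ _ H env (fun x => mkadd (gB x)) g_nat) => x a; apply: gprodP => -[z zx].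
rewrite /= /g_fun /= -smor_nat hi smor_nat /= /env_bond_fun /=.
refine (@env_eq x (f x a) z _ _).
Qed.
End InjectiveEnvelope.

Section Cokernel.
Variables (d : Order.disp_t) (P : porderType d) (F G : invsys P) (i : sysmor F G).

Definition coker_obj x : zmodType := quotg (img (i x)).

Lemma coker_subproof x y (h : (x <= y)%O) a : a \in img (i y) ->
  (quotpi (img (i x)) \o bond G h) a = 0.
Proof.
move=> /imgP[b ->]; apply/quotpi_eq0/imgP.
by exists (bond F h b); rewrite smor_nat.
Qed.

Definition coker_bond x y (h : (x <= y)%O) :
  {additive coker_obj y -> coker_obj x} := quotlift (@coker_subproof x y h).

Lemma coker_bondE x y (h : (x <= y)%O) a :
  coker_bond h (quotpi (img (i y)) a) = quotpi (img (i x)) (bond G h a).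
Proof. exact: quotliftE. Qed.

Definition coker : invsys P.
Proof.
exists coker_obj coker_bond.
  by move=> x h a; rewrite -[a]quotpi_reprK coker_bondE bond_id.
move=> x y z hxy hyz hxz a; rewrite -[a]quotpi_reprK !coker_bondE.
by rewrite (bond_comp _ _ hxz).
Defined.

Definition to_coker : sysmor G coker.
Proof.
by exists (fun x => quotpi (img (i x))) => x y h a; rewrite -coker_bondE.
Defined.

Lemma to_coker_eq0 x a : to_coker x a = 0 <-> exists b, a = i x b.
Proof. by split=> [/quotpi_eq0/imgP|h] //; apply/quotpi_eq0/imgP. Qed.

Lemma to_coker_surj x q : exists a, q = to_coker x a.
Proof. exists (repr (q : Quotient.quot (img (i x)))); exact/esym/quotpi_reprK. Qed.
End Cokernel.

Section ResolutionExists.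
Variables (d : Order.disp_t) (P : porderType d) (G : invsys P).

Fixpoint cosyzygy n : invsys P :=
  if n is m.+1 then coker (to_env (cosyzygy m)) else G.

Definition env_d n : sysmor (env (cosyzygy n)) (env (cosyzygy n.+1)) :=
  syscomp (to_env (cosyzygy n.+1)) (to_coker (to_env (cosyzygy n))).

Lemma env_d_eq0 n x a : env_d n x a = 0 <-> exists b, a = to_env (cosyzygy n) x b.
Proof.
rewrite -to_coker_eq0 syscompE; split=> [h|->]; last exact: raddf0.
by apply: (@to_env_mono _ _ (cosyzygy n.+1) x); rewrite h raddf0.
Qed.

Lemma env_exactS n x a : env_d n.+1 x a = 0 <-> exists b, a = env_d n x b.
Proof.
rewrite env_d_eq0; split=> -[b ->]; last by exists (to_coker _ x b).
by have [c ->] := to_coker_surj b; exists c.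
Qed.

Definition env_resolution : resolution G :=
  @Resolution _ _ G (fun n => env (cosyzygy n)) (to_env G) env_d
    (@to_env_mono _ _ G) (@env_d_eq0 0) env_exactS.

Lemma env_resolution_injective : injective_resolution env_resolution.
Proof. by move=> n; apply: env_injective. Qed.
End ResolutionExists.

Section Extension.
Variables (d : Order.disp_t) (P : porderType d) (F G J : invsys P).
Variables (v : sysmor F G) (h : sysmor F J).
Hypothesis vh : forall x a, v x a = 0 -> h x a = 0.

Definition im_obj x : zmodType := subgrp (img (v x)).

Lemma im_bond_subproof x y (le_xy : (x <= y)%O) (c : im_obj y) :
  bond G le_xy (val c) \in img (v x).
Proof.
have /imgP[b cb] := valP c.
by apply/imgP; exists (bond F le_xy b); rewrite cb smor_nat.
Qed.

Lemma im_bond_morph x y (le_xy : (x <= y)%O) :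
  {morph (fun c => sgproj (im_bond_subproof le_xy c)) : a b / a - b}.
Proof. by move=> a b; apply: val_inj; rewrite /= raddfB. Qed.

Definition im_sys : invsys P.
Proof.
exists im_obj (fun x y le_xy => mkadd (@im_bond_morph x y le_xy)).
  by move=> x le_xx a; apply: val_inj; rewrite /= bond_id.
by move=> x y z hxy hyz hxz a; apply: val_inj; rewrite /= (bond_comp _ _ hxz).
Defined.

Definition im_incl : sysmor im_sys G.
Proof. by exists (fun x => sgval (img (v x))). Defined.

Lemma im_lift_ex x (c : im_obj x) : exists b, val c = v x b.
Proof. by apply/imgP; apply: valP. Qed.

Definition im_map_fun x (c : im_obj x) : J x := h x (sval (cid (im_lift_ex c))).

Lemma im_map_funE x (c : im_obj x) b : val c = v x b -> im_map_fun c = h x b.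
Proof.
rewrite /im_map_fun; case: cid => a /= -> vab.
by apply/eqP; rewrite -subr_eq0 -raddfB; apply/eqP/vh; rewrite raddfB vab subrr.
Qed.

Lemma im_map_morph x : {morph @im_map_fun x : a b / a - b}.
Proof.
move=> a b; have [a' aE] := im_lift_ex a; have [b' bE] := im_lift_ex b.
rewrite (im_map_funE aE) (im_map_funE bE) -raddfB.
by apply: im_map_funE; rewrite /= aE bE raddfB.
Qed.

Definition im_map : sysmor im_sys J.
Proof.
exists (fun x => mkadd (@im_map_morph x)) => x y le_xy c.
have [b cb] := im_lift_ex c; rewrite /= (im_map_funE cb) -smor_nat.
by apply: im_map_funE; rewrite /= cb smor_nat.
Defined.

Lemma injective_extend : injective_sys J ->
  exists k : sysmor G J, forall x a, k x (v x a) = h x a.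
Proof.
move=> injJ; have [|k kE] := injJ im_sys G im_incl im_map.
  by move=> x a b; apply: val_inj.
exists k => x a; have va : v x a \in img (v x) by apply/imgP; exists a.
transitivity (im_map x (sgproj va)); first by rewrite -kE.
exact: im_map_funE.
Qed.
End Extension.

Section Comparison.
Variables (d : Order.disp_t) (P : porderType d) (F G : invsys P).
Variables (f : sysmor F G) (R : resolution F) (S : resolution G).
Hypothesis injS : injective_resolution S.

Let stage n := {phi : sysmor (R n) (S n) |
  forall x a, rsd R n x a = 0 -> rsd S n x (phi x a) = 0}.

Let stage0 : exists phi : sysmor (R 0) (S 0),
  forall x a, phi x (rsaug R x a) = rsaug S x (f x a).
Proof. exact: injS (syscomp (rsaug S) f) (@rs_mono _ _ _ R). Qed.

Let stageS n (phi : stage n) : exists psi : sysmor (R n.+1) (S n.+1),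
  forall x a, psi x (rsd R n x a) = rsd S n x (sval phi x a).
Proof.
apply: (@injective_extend _ _ _ _ _ (rsd R n) (syscomp (rsd S n) (sval phi))) => //.
exact: (svalP phi).
Qed.

Let stages : forall n, stage n.
Proof.
elim=> [|n phi].
  exists (sval (cid stage0)); case: cid => phi /= phiE x a /rs_exact0[b ->].
  by rewrite phiE; apply/rs_exact0; exists (f x b).
exists (sval (cid (stageS phi))); case: cid => psi /= psiE x a /rs_exactS[b ->].
by rewrite psiE rsdd.
Defined.

Lemma comparison_exists : exists phi : resmor f R S, True.
Proof.
suff [aug dE] : (forall x a, sval (stages 0) x (rsaug R x a) = rsaug S x (f x a))
    /\ (forall n x a, sval (stages n.+1) x (rsd R n x a) =
          rsd S n x (sval (stages n) x a)).
  by exists (ResMor (rmor := fun n => sval (stages n)) aug dE).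
split=> [x a|n x a] /=; case: cid => psi //=.
Qed.

Definition comparison : resmor f R S := sval (cid comparison_exists).
End Comparison.

Section DerivedLimit.
Variables (d : Order.disp_t) (P : porderType d).

Lemma injective_resolution_exists (G : invsys P) :
  exists R : resolution G, injective_resolution R.
Proof. by exists (env_resolution G); apply: env_resolution_injective. Qed.

(* The derived functors are computed from a chosen injective resolution of each
   system, and maps between them from a chosen chain map; as usual, other
   choices give canonically isomorphic groups and, up to these, equal maps. *)
Definition the_resolution (G : invsys P) : resolution G :=
  sval (cid (injective_resolution_exists G)).

Lemma the_resolution_injective (G : invsys P) :
  injective_resolution (the_resolution G).
Proof. by rewrite /the_resolution; case: cid. Qed.

Definition Rlim n (G : invsys P) : zmodType :=
  cohomology (lim_complex (the_resolution G)) n.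

Definition Rlim_map n (F G : invsys P) (f : sysmor F G) :
    {additive Rlim n F -> Rlim n G} :=
  cohomology_map
    (lim_cxmor (comparison f (the_resolution F) (@the_resolution_injective G))) n.
End DerivedLimit.

Section Pullback.
Variables (d d' : Order.disp_t) (P : porderType d) (Q : porderType d').
Variables (e : P -> Q) (e_homo : {homo e : x y / (x <= y)%O}).

Definition pullback (G : invsys Q) : invsys P.
Proof.
exists (fun x => G (e x)) (fun x y h => bond G (e_homo h)).
  by move=> x h a; apply: bond_id.
by move=> x y z hxy hyz hxz a; apply: bond_comp.
Defined.

Definition pullback_mor (F G : invsys Q) (f : sysmor F G) :
  sysmor (pullback F) (pullback G).
Proof. by exists (fun x => f (e x)) => x y h a; exact: (smor_nat f (e_homo h) a). Defined.

Section Resolution.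
Variables (G : invsys Q) (R : resolution G).

Lemma pullback_mono : sysmor_mono (pullback_mor (rsaug R)).
Proof. by move=> x; move=> a b; exact: (@rs_mono _ _ _ R (e x) a b). Qed.

Lemma pullback_exact0 x a : pullback_mor (rsd R 0) x a = 0 <->
  exists b, a = pullback_mor (rsaug R) x b.
Proof. exact: (@rs_exact0 _ _ _ R (e x) a). Qed.

Lemma pullback_exactS n x a : pullback_mor (rsd R n.+1) x a = 0 <->
  exists b, a = pullback_mor (rsd R n) x b.
Proof. exact: (@rs_exactS _ _ _ R n (e x) a). Qed.

Definition pullback_resolution : resolution (pullback G) :=
  @Resolution _ _ (pullback G) (fun n => pullback (R n))
    (pullback_mor (rsaug R)) (fun n => pullback_mor (rsd R n))
    pullback_mono pullback_exact0 pullback_exactS.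
End Resolution.

Section Limit.
Variable G : invsys Q.

Lemma lim_pullback_subproof (t : syslim G) :
  thread_prop ((fun x => val t (e x)) : gprod (pullback G)).
Proof. by move=> x y h; exact: (syslim_thread t (e_homo h)). Qed.

Definition lim_pullback_fun (t : syslim G) : syslim (pullback G) :=
  mkthread (lim_pullback_subproof t).

Lemma lim_pullback_morph : {morph lim_pullback_fun : s t / s - t}.
Proof. by move=> s t; apply: syslimP. Qed.

Definition lim_pullback : {additive syslim G -> syslim (pullback G)} :=
  mkadd lim_pullback_morph.
End Limit.

Section Derived.
Variable G : invsys Q.

Lemma lim_pullback_cx_subproof (R : resolution G) n (t : lim_complex R n) :
  lim_pullback (R n.+1) (cxd (lim_complex R) n t) =
  cxd (lim_complex (pullback_resolution R)) n (lim_pullback (R n) t).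
Proof. by apply: syslimP => x. Qed.

Definition lim_pullback_cx (R : resolution G) :
    cxmor (lim_complex R) (lim_complex (pullback_resolution R)) :=
  @CxMor (lim_complex R) (lim_complex (pullback_resolution R))
    (fun n => lim_pullback (R n)) (@lim_pullback_cx_subproof R).

(* The pullback of an injective resolution is a resolution, in general not an
   injective one, so the comparison with the chosen injective resolution of
   [pullback G] is needed. *)
Definition Rlim_pullback n : {additive Rlim n G -> Rlim n (pullback G)} :=
  cohomology_map
    (lim_cxmor (comparison (sysid (pullback G))
      (pullback_resolution (the_resolution G))
      (@the_resolution_injective _ _ (pullback G)))) n \o
  cohomology_map (lim_pullback_cx (the_resolution G)) n.
End Derived.
End Pullback.

(* A cardinal is represented by an index type: under the axiom of choice every
   type carries a [choiceType] structure, so no cardinal is excluded.  An Omega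
   system consists of the systems G_alpha indexed by omega = [nat]. *)
Definition Omega_system (kappa : Type) := kappa -> invsys nat.

Section OmegaSystem.
Variables (kappa : choiceType) (G : Omega_system kappa).

Lemma omega_le (x y : kappa -> nat) (h : (x <= y)%O) alpha :
  (x alpha <= y alpha)%O.
Proof. exact: (lefP _ _ h). Qed.

Definition omega_bond (x y : kappa -> nat) (h : (x <= y)%O) :
    {additive gsum (fun alpha => G alpha (y alpha)) ->
              gsum (fun alpha => G alpha (x alpha))} :=
  gsum_map (fun alpha => bond (G alpha) (omega_le h alpha)).

Definition omega_sys : invsys (kappa -> nat).
Proof.
exists (fun x => gsum (fun alpha => G alpha (x alpha))) omega_bond.
  by move=> x h a; apply: gsumP => alpha; apply: bond_id.
by move=> x y z hxy hyz hxz a; apply: gsumP => alpha; apply: bond_comp.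
Defined.

Lemma ev_homo alpha :
  {homo (fun x : kappa -> nat => x alpha) : x y / (x <= y)%O}.
Proof. by move=> x y h; apply: omega_le. Qed.

Lemma omega_in_nat alpha (x y : kappa -> nat) (h : (x <= y)%O)
    (a : G alpha (y alpha)) :
  gsum_in (fun beta => G beta (x beta)) alpha (bond (G alpha) (ev_homo alpha h) a) =
  omega_bond h (gsum_in (fun beta => G beta (y beta)) alpha a).
Proof.
apply: gsumP => beta; rewrite /=.
have [<-|ab] := eqVneq alpha beta.
  rewrite !eqtype.dfwith_in; congr (bond _ _ _); exact: bool_irrelevance.
by rewrite !eqtype.dfwith_out// raddf0.
Qed.

Definition omega_in alpha :
    sysmor (pullback (ev_homo alpha) (G alpha)) omega_sys :=
  @SysMor _ _ (pullback (ev_homo alpha) (G alpha)) omega_sys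
    (fun x => gsum_in (fun beta => G beta (x beta)) alpha)
    (@omega_in_nat alpha).

(* On the alpha-th summand this is lim^n G_alpha -> lim^n (pullback of G_alpha)
   followed by the map induced by the inclusion into the direct sum system. *)
Definition canonical_map n :
    {additive gsum (fun alpha => Rlim n (G alpha)) -> Rlim n omega_sys} :=
  gsum_out (fun alpha =>
    Rlim_map n (omega_in alpha) \o Rlim_pullback (ev_homo alpha) (G alpha) n).
End OmegaSystem.

Section Zpow.

Definition zproj_fun j k (h : (k <= j)%O) (v : 'rV[int]_j) : 'rV[int]_k :=
  \row_i v ord0 (widen_ord h i).

Lemma zproj_morph j k (h : (k <= j)%O) : {morph zproj_fun h : u v / u - v}.
Proof. by move=> u v; apply/rowP => i; rewrite !mxE. Qed.

Definition zproj j k (h : (k <= j)%O) : {additive 'rV[int]_j -> 'rV[int]_k} :=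
  mkadd (zproj_morph h).

Definition zpow : invsys nat.
Proof.
exists (fun k => 'rV[int]_k) (fun k j h => zproj h).
  by move=> k h a; apply/rowP => i; rewrite mxE; congr (a _ _); apply: val_inj.
by move=> i j k hij hjk hik a; apply/rowP => l; rewrite !mxE; congr (a _ _); apply: val_inj.
Defined.
End Zpow.

(* Z^k in every component, so [omega_sys (A_system kappa)] is the system
   x |-> (+)_alpha Z^(x alpha). *)
Definition A_system (kappa : Type) : Omega_system kappa := fun=> zpow.
Arguments A_system kappa : clear implicits.

(* Main.v *)
From HB Require Import structures.
From mathcomp Require Import all_boot all_order all_algebra.
From mathcomp Require Import boolp classical_sets cardinality.
Require Import Defs.

(* Say that a system G is s-acyclic when lim^(s+1) G = 0.  Every system embeds
   in the coinduced system x |-> prod_(z <= x) G z, which is acyclic, and the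
   cokernel of this embedding is an exact functor of G; iterating it describes
   acyclicity by explicit 1-cocycles, gives the vanishing part of the long exact
   sequence, and agrees with the cohomology of any resolution by acyclic systems.

   For a tower T of finitely generated groups with onto bonding maps there is an
   exact sequence 0 -> (Z^g(k))_k -> (Z^f(k))_k -> T -> 0 with f, g strictly
   increasing.  The Omega system of the towers Z^f is the pullback of A_kappa
   along x |-> f o x; this map has a Galois adjoint, so the pullback preserves
   injectives and limits, and lim^s = 0 for 1 <= s <= n + 1 passes from A_kappa to
   Z^f and Z^g, and then for 1 <= s <= n to T.  An arbitrary tower G sits in
   0 -> G -> coind G -> C -> 0 where both other towers have onto bonding maps.
   Hence for n >= 2 both sides of the canonical map vanish.  In degrees 0 and 1
   the classes are represented by threads and by 1-cocycles, compatibly with the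
   canonical map, and the claim reduces to the fact that lim^0 commutes with the
   direct sum, applied to G and to C respectively. *)

Set Implicit Arguments.
Unset Strict Implicit.
Unset Printing Implicit Defensive.

Import Order.TTheory GRing.Theory Num.Theory.

Local Open Scope ring_scope.

(** * Acyclic systems *)

Lemma dep_choice (I : Type) (A : I -> Type) (R : forall i, A i -> Prop) :
  (forall i, exists a, R i a) -> exists f : forall i, A i, forall i, R i (f i).
Proof. by move=> /(_ _)/cid RA; exists (fun i => sval (RA i)) => i; exact: svalP. Qed.

Lemma subrACA (V : zmodType) (a b c e : V) : a - b - (c - e) = a - c - (b - e).
Proof. by rewrite !opprB addrACA [RHS]addrACA [- b - c]addrC. Qed.

Section ShortExact.
Variables (d : Order.disp_t) (P : porderType d).
Implicit Types F G H : invsys P.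

Definition short_exact F G H (i : sysmor F G) (p : sysmor G H) :=
  [/\ sysmor_mono i,
      forall x b, p x b = 0 <-> exists a, b = i x a
    & forall x c, exists b, c = p x b].

Definition lim_surj F G (p : sysmor F G) :=
  forall t : syslim G, exists s : syslim F, t = syslim_map p s.

Lemma to_coker_exact F G (i : sysmor F G) :
  sysmor_mono i -> short_exact i (to_coker i).
Proof.
move=> mi; split=> // x c; first exact: to_coker_eq0.
exact: to_coker_surj.
Qed.

Section CokerMap.
Variables (A B C D : invsys P) (i : sysmor A B) (j : sysmor C D) (g : sysmor B D).
Hypothesis gij : forall x a, exists c, g x (i x a) = j x c.

Lemma coker_map_subproof x b : b \in img (i x) -> (to_coker j x \o g x) b = 0.
Proof. by move=> /imgP[a ->]; apply/to_coker_eq0; apply: gij. Qed.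

Definition coker_map_fun x : {additive coker i x -> coker j x} :=
  quotlift (@coker_map_subproof x).

Lemma coker_map_funE x b : coker_map_fun x (to_coker i x b) = to_coker j x (g x b).
Proof. exact: quotliftE. Qed.

Definition coker_map : sysmor (coker i) (coker j).
Proof.
exists coker_map_fun => x y h a; have [b ->] := to_coker_surj a.
by rewrite -smor_nat !coker_map_funE !smor_nat.
Defined.

Lemma coker_mapE x b : coker_map x (to_coker i x b) = to_coker j x (g x b).
Proof. exact: coker_map_funE. Qed.
End CokerMap.

(** These are the 1-cochains of the standard complex of a system, and [bounds] is the coboundary
    relation. Its cohomology in degree 1 is a model of lim^1, so [acyc1] expresses that lim^1
    vanishes. *)
Definition cochain1 G := forall x y : P, (x <= y)%O -> G x.

Definition cocycle1 G (g : cochain1 G) :=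
  forall x y z (hxy : (x <= y)%O) (hyz : (y <= z)%O) (hxz : (x <= z)%O),
    g x z hxz = g x y hxy + bond G hxy (g y z hyz).

Definition bounds G (g : cochain1 G) (e : forall x, G x) :=
  forall x y (h : (x <= y)%O), g x y h = bond G h (e y) - e x.

Lemma bounds_cocycle G (g : cochain1 G) e : bounds g e -> cocycle1 g.
Proof.
move=> ge x y z hxy hyz hxz; rewrite !ge raddfB (bond_comp _ _ hxz).
by rewrite [RHS]addrC addrA subrK.
Qed.

Definition cochain1_map F G (f : sysmor F G) (g : cochain1 F) : cochain1 G :=
  fun x y h => f x (g x y h).

Lemma cocycle1_map F G (f : sysmor F G) (g : cochain1 F) :
  cocycle1 g -> cocycle1 (cochain1_map f g).
Proof.
move=> cg x y z hxy hyz hxz.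
by rewrite /cochain1_map (cg _ _ _ hxy hyz) raddfD smor_nat.
Qed.

Lemma cocycle1_mono F G (f : sysmor F G) (g : cochain1 F) :
  sysmor_mono f -> cocycle1 (cochain1_map f g) -> cocycle1 g.
Proof.
move=> mf cg x y z hxy hyz hxz; apply: mf.
by rewrite raddfD smor_nat; exact: cg.
Qed.

Definition acyc1 G := forall g : cochain1 G, cocycle1 g -> exists e, bounds g e.

(** * Coinduced systems and cosyzygies *)

Section Coinduced.
Variable A : P -> zmodType.

Definition coind_obj (x : P) : zmodType := gprod (fun z : down x => A (sval z)).

Definition coind_bond_fun x y (h : (x <= y)%O) (t : coind_obj y) : coind_obj x :=
  fun z => t (down_widen h z).

Lemma coind_bond_morph x y (h : (x <= y)%O) :
  {morph coind_bond_fun h : s t / s - t}.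
Proof. by move=> s t; apply: gprodP. Qed.

Lemma coind_eq x (t : coind_obj x) (z : P) (h1 h2 : (z <= x)%O) :
  t (exist _ z h1) = t (exist _ z h2).
Proof. by rewrite (bool_irrelevance h1 h2). Qed.

Definition coind : invsys P.
Proof.
exists coind_obj (fun x y h => mkadd (@coind_bond_morph x y h)).
  by move=> x h a; apply: gprodP => -[z zx]; rewrite /=; refine (@coind_eq x a z _ _).
move=> x y z hxy hyz hxz a; apply: gprodP => -[w wx].
rewrite /=; refine (@coind_eq z a w _ _).
Defined.

Lemma coind_bondE x y (h : (x <= y)%O) (t : coind y) z (zx : (z <= x)%O) zy :
  bond coind h t (exist _ z zx) = t (exist _ z zy).
Proof. rewrite /=; refine (@coind_eq y t z _ _). Qed.

(** The [z]-coordinate of the bounding cochain at [x] is the top coordinate of [g z x]; the cocycle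
    identity for [z <= x <= y] is then the claim. *)
Lemma coind_acyc1 : acyc1 coind.
Proof.
move=> g cg.
exists (fun x (z : down x) => g (sval z) x (proj2_sig z) (exist _ (sval z) (lexx _))).
move=> x y h; apply: gprodP => -[z zx]; have zy := le_trans zx h.
rewrite gprodB (coind_bondE _ _ _ zy) /=.
rewrite (cg z x y zx h zy).
rewrite gprodD addrAC subrr add0r; exact/esym/coind_bondE.
Qed.
End Coinduced.

Section CoinducedMap.
Variables (A B : P -> zmodType) (f : forall x, {additive A x -> B x}).

Definition coind_map_fun x (a : coind A x) : coind B x := fun z => f (sval z) (a z).

Lemma coind_map_morph x : {morph @coind_map_fun x : s t / s - t}.
Proof. by move=> s t; apply: gprodP => z; rewrite /coind_map_fun !gprodB raddfB. Qed.

Definition coind_map : sysmor (coind A) (coind B).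
Proof. by exists (fun x => mkadd (@coind_map_morph x)). Defined.
End CoinducedMap.

Section ToCoinduced.
Variable G : invsys P.

Definition to_coind_fun x (a : G x) : coind G x := fun z => bond G (proj2_sig z) a.

Lemma to_coind_morph x : {morph @to_coind_fun x : s t / s - t}.
Proof. by move=> s t; apply: gprodP => z; rewrite gprodB /to_coind_fun raddfB. Qed.

Definition to_coind : sysmor G (coind G).
Proof.
exists (fun x => mkadd (@to_coind_morph x)) => x y h a.
by apply: gprodP => -[z zx]; exact: bond_comp.
Defined.

Lemma to_coind_mono : sysmor_mono to_coind.
Proof.
move=> x a b /(congr1 (fun t : coind G x => t (exist _ x (lexx x)))) /=.
by rewrite /to_coind_fun !bond_id.
Qed.

Definition cosyz : invsys P := coker to_coind.

Lemma cosyz_exact : short_exact to_coind (to_coker to_coind).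
Proof. exact/to_coker_exact/to_coind_mono. Qed.
End ToCoinduced.

Section CosyzMap.
Variables (F G : invsys P) (f : sysmor F G).

Lemma coind_map_nat x a : coind_map f x (to_coind F x a) = to_coind G x (f x a).
Proof. by apply: gprodP => z; exact: smor_nat. Qed.

Lemma cosyz_map_subproof x a :
  exists c, coind_map f x (to_coind F x a) = to_coind G x c.
Proof. by exists (f x a); exact: coind_map_nat. Qed.

Definition cosyz_map : sysmor (cosyz F) (cosyz G) := coker_map cosyz_map_subproof.

Lemma cosyz_mapE x b :
  cosyz_map x (to_coker (to_coind F) x b) = to_coker (to_coind G) x (coind_map f x b).
Proof. exact: coker_mapE. Qed.
End CosyzMap.

(* Indices are shifted: [acyc s G] says that lim^(s+1) G = 0. *)
Fixpoint acyc s G : Prop := if s is s'.+1 then acyc s' (cosyz G) else acyc1 G.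

Lemma coind_exact F G H (i : sysmor F G) (p : sysmor G H) :
  short_exact i p -> short_exact (coind_map i) (coind_map p).
Proof.
move=> [mi ep sp]; split=> [x a b ab|x b|x c].
- apply: gprodP => z; apply: mi.
  exact: (congr1 (fun t : coind G x => t z) ab).
- split=> [pb|[a ->]]; last by apply: gprodP => z; apply/ep; exists (a z).
  have /dep_choice[a ab] (z : down x) : exists a, b z = i (sval z) a.
    by apply/ep; exact: (congr1 (fun t : coind H x => t z) pb).
  by exists a; apply: gprodP.
have /dep_choice[b bc] (z : down x) : exists b, c z = p (sval z) b by exact: sp.
by exists b; apply: gprodP.
Qed.

(** This is the 3x3 lemma: the given sequence and its coinduced one are exact, and [to_coind] embeds
    the first in the second, so the cokernels form an exact sequence. *)
Lemma cosyz_map_exact F G H (i : sysmor F G) (p : sysmor G H) :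
  short_exact i p -> short_exact (cosyz_map i) (cosyz_map p).
Proof.
move=> eip; have [mi ep sp] := eip; have [mci ecp scp] := coind_exact eip.
split=> [x|x b|x c].
- apply: raddf_inj => a; have [a' ->] := to_coker_surj a.
  rewrite coker_mapE => /to_coker_eq0[b ab]; apply/to_coker_eq0.
  have /ep[c bc] : p x b = 0.
    apply: (@to_coind_mono H x); rewrite -coind_map_nat -ab raddf0.
    by apply/ecp; exists a'.
  by exists c; apply: mci; rewrite coind_map_nat ab bc.
- have [b' ->] := to_coker_surj b; rewrite coker_mapE to_coker_eq0; split.
    (* A preimage [e] of [c] corrects [b'] so that its image in [coind H] vanishes; the correction
       itself dies in [cosyz G]. *)
    move=> [c pb]; have [e ce] := sp _ c.
    have /ecp[a ba] : coind_map p x (b' - to_coind G x e) = 0.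
      by rewrite raddfB coind_map_nat pb -ce subrr.
    exists (to_coker _ x a); rewrite coker_mapE -ba raddfB.
    rewrite [X in _ - X](_ : _ = 0) ?subr0//.
    by apply/to_coker_eq0; exists e.
  move=> [a]; have [a' ->] := to_coker_surj a; rewrite coker_mapE => /eqP.
  rewrite -subr_eq0 -raddfB => /eqP/to_coker_eq0[e be].
  exists (p x e); rewrite -coind_map_nat -be raddfB.
  rewrite [X in _ - X](_ : _ = 0) ?subr0//.
  by apply/ecp; exists a'.
have [c' ->] := to_coker_surj c; have [b ->] := scp _ c'.
by exists (to_coker _ x b); rewrite coker_mapE.
Qed.

(** * Derived limits along a short exact sequence *)

Section Sequence.
Variables (F G H : invsys P) (i : sysmor F G) (p : sysmor G H).
Hypothesis eip : short_exact i p.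

Lemma lift_cocycle1 (g : cochain1 G) : cocycle1 g ->
  (forall x y h, p x (g x y h) = 0) ->
  exists2 a : cochain1 F, cocycle1 a & forall x y h, g x y h = i x (a x y h).
Proof.
have [mi ep sp] := eip => cg pg.
have E x y h : exists a, g x y h = i x a by apply/ep.
exists (fun x y h => sval (cid (E x y h))) => [|x y h]; last by case: cid.
apply: (cocycle1_mono mi) => x y z hxy hyz hxz; rewrite /cochain1_map.
by do 3 case: cid => /= ? <-; exact: cg.
Qed.

(** Levelwise preimages [b] of [t] fail to form a thread by a 1-cocycle with values in [F]; a
    cochain bounding it corrects [b]. *)
Lemma acyc1_lim_surj : acyc1 F -> lim_surj p.
Proof.
have [mi ep sp] := eip => aF t.
have /dep_choice[b bt] x : exists b, val t x = p x b by exact: sp.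
pose g : cochain1 G := fun x y h => bond G h (b y) - b x.
have [|x y h|a ca ga] := @lift_cocycle1 g; first exact: (@bounds_cocycle _ _ b).
  by rewrite raddfB smor_nat -!bt syslim_thread subrr.
have [e ae] := aF a ca.
have sP : thread_prop ((fun x => b x - i x (e x)) : gprod G).
  move=> x y h; apply/eqP; rewrite -subr_eq0 raddfB subrACA -smor_nat -raddfB.
  by rewrite -ae -ga subrr.
exists (mkthread sP); apply: syslimP => x; rewrite syslim_mapE /= raddfB bt.
by rewrite [X in _ - X](_ : _ = 0) ?subr0//; apply/ep; exists (e x).
Qed.

(** A cocycle of [F] is bounded in [G] by some [b] whose image in [H] is a thread; subtracting a
    thread that lifts this image moves [b] into [F]. *)
Lemma lim_surj_acyc1 : lim_surj p -> acyc1 G -> acyc1 F.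
Proof.
have [mi ep sp] := eip => lp aG g cg.
have [b gb] := aG _ (cocycle1_map i cg).
have tP : thread_prop ((fun x => p x (b x)) : gprod H).
  move=> x y h; rewrite -smor_nat; apply/eqP; rewrite -subr_eq0 -raddfB -gb.
  by apply/eqP/ep; exists (g x y h).
have [s ts] := lp (mkthread tP).
have /dep_choice[e ebs] x : exists e, b x - val s x = i x e.
  apply/ep; rewrite raddfB -syslim_mapE -ts; exact: subrr.
exists e => x y h; apply: mi; rewrite raddfB smor_nat -!ebs raddfB syslim_thread.
by rewrite opprB addrA subrK; exact: gb.
Qed.
End Sequence.

Lemma cosyz_lim_surj G : acyc1 G <-> lim_surj (to_coker (to_coind G)).
Proof.
split; first exact/acyc1_lim_surj/cosyz_exact.
by move/lim_surj_acyc1; apply; [exact: cosyz_exact|exact: coind_acyc1].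
Qed.

(** This comes from lim^(s+1) G -> lim^(s+1) H -> lim^(s+2) F. Cosyzygies lower the degree to
    [s = 0], where a thread of [cosyz H] is lifted to [cosyz G], then to [coind G], and pushed to
    [coind H]. *)
Lemma acyc_quotient s F G H (i : sysmor F G) (p : sysmor G H) :
  short_exact i p -> acyc s G -> acyc s.+1 F -> acyc s H.
Proof.
elim: s F G H i p => [|s IH] F G H i p eip; last first.
  by move=> aG aF; apply: IH (cosyz_map_exact eip) aG aF.
move=> /cosyz_lim_surj aG aF; apply/cosyz_lim_surj => t.
have [q ->] := acyc1_lim_surj (cosyz_map_exact eip) aF t.
have [b ->] := aG q; exists (syslim_map (coind_map p) b).
by apply: syslimP => x; exact: coker_mapE.
Qed.

(** This comes from lim^(s+1) H -> lim^(s+2) F -> lim^(s+2) G. For [s = 0] a thread of [cosyz H] is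
    lifted to [coind H], then to [coind G] since [coind F] is acyclic, and pushed to [cosyz G]. *)
Lemma acyc_sub s F G H (i : sysmor F G) (p : sysmor G H) :
  short_exact i p -> acyc s H -> acyc s.+1 G -> acyc s.+1 F.
Proof.
elim: s F G H i p => [|s IH] F G H i p eip; last first.
  by move=> aG aF; apply: IH (cosyz_map_exact eip) aG aF.
move=> /cosyz_lim_surj aH aG; apply: (lim_surj_acyc1 (cosyz_map_exact eip)) aG.
move=> t; have [c ->] := aH t.
have [b ->] := acyc1_lim_surj (coind_exact eip) (@coind_acyc1 F) c.
exists (syslim_map (to_coker (to_coind G)) b).
by apply: syslimP => x; exact/esym/coker_mapE.
Qed.

Lemma acyc_retract s F G (i : sysmor F G) (r : sysmor G F) :
  (forall x a, r x (i x a) = a) -> acyc s G -> acyc s F.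
Proof.
elim: s F G i r => [|s IH] F G i r ri.
  move=> aG g cg; have [e ge] := aG _ (cocycle1_map i cg).
  exists (fun x => r x (e x)) => x y h.
  by rewrite -smor_nat -raddfB -ge /cochain1_map ri.
apply: (IH _ _ (cosyz_map i) (cosyz_map r)) => x a.
have [b ->] := to_coker_surj a; rewrite !cosyz_mapE.
by congr (to_coker _ _ _); apply: gprodP => z; rewrite /= /coind_map_fun /= ri.
Qed.

Section SplitCoker.
Variables (F G : invsys P) (i : sysmor F G) (r : sysmor G F).
Hypothesis ri : forall x a, r x (i x a) = a.

(** The projection [b - i (r b)] kills the image of [i], so it exhibits the cokernel of a split
    monomorphism as a retract of [G]. *)
Lemma split_proj_morph x : {morph (fun b => b - i x (r x b)) : s t / s - t}.
Proof. by move=> s t /=; rewrite (raddfB (r x)) (raddfB (i x)) subrACA. Qed.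

Lemma split_proj_subproof x b : b \in img (i x) -> mkadd (@split_proj_morph x) b = 0.
Proof. by move=> /imgP[a ->]; rewrite /= ri subrr. Qed.

Definition split_incl_fun x : {additive coker i x -> G x} :=
  quotlift (@split_proj_subproof x).

Lemma split_incl_funE x b : split_incl_fun x (to_coker i x b) = b - i x (r x b).
Proof. exact: quotliftE. Qed.

Definition split_incl : sysmor (coker i) G.
Proof.
exists split_incl_fun => x y h q; have [b ->] := to_coker_surj q.
by rewrite -smor_nat !split_incl_funE raddfB !smor_nat.
Defined.

Lemma acyc_split_coker s : acyc s G -> acyc s (coker i).
Proof.
apply: (acyc_retract (i := split_incl) (r := to_coker i)) => x q.
have [b ->] := to_coker_surj q; rewrite [split_incl x _]split_incl_funE raddfB.
by rewrite [X in _ - X](_ : _ = 0) ?subr0//; apply/to_coker_eq0; exists (r x b).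
Qed.
End SplitCoker.

(** A retraction of [to_coind (coind A)]: of each member of the family only the top coordinate is
    kept. *)
Definition coind_retr_fun (A : P -> zmodType) x (t : coind (coind A) x) : coind A x :=
  fun z => t z (exist _ (sval z) (lexx _)).

Lemma coind_retr_morph (A : P -> zmodType) x : {morph @coind_retr_fun A x : s t / s - t}.
Proof. by move=> s t; apply: gprodP. Qed.

Definition coind_retr (A : P -> zmodType) : sysmor (coind (coind A)) (coind A).
Proof. by exists (fun x => mkadd (@coind_retr_morph A x)). Defined.

Lemma acyc_coind s (A : P -> zmodType) : acyc s (coind A).
Proof.
elim: s A => [|s IH] A; first exact: coind_acyc1.
apply: (@acyc_split_coker _ _ (to_coind (coind A)) (coind_retr A)) (IH _) => x a.
apply: gprodP => -[z zx]; rewrite /= /coind_retr_fun /to_coind_fun /=.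
exact: coind_bondE.
Qed.

(** An injective [J] is a retract of [coind J], which settles the lowest degree; in higher degrees
    [cosyz J] is a retract of [coind J] as well. *)
Lemma acyc_injective s (J : invsys P) : injective_sys J -> acyc s J.
Proof.
move=> /(_ _ _ _ (sysid J) (@to_coind_mono J))[r ri]; case: s => [|s].
  by apply: (@acyc_retract 0 _ _ (to_coind J) r) => //; exact: acyc_coind.
by apply: (@acyc_split_coker _ _ (to_coind J) r) => //; exact: acyc_coind.
Qed.

(** * Resolutions by acyclic systems *)

Definition lim_exact G (R : resolution G) s :=
  forall t : syslim (R s.+1), syslim_map (rsd R s.+1) t = 0 ->
    exists u, t = syslim_map (rsd R s) u.

Section Shift.
Variables (G : invsys P) (R : resolution G).

Let C := coker (rsaug R).

Lemma shift_aug_subproof x b : b \in img (rsaug R x) -> rsd R 0 x b = 0.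
Proof. by move=> /imgP h; apply/rs_exact0. Qed.

Definition shift_aug_fun x : {additive C x -> R 1 x} :=
  quotlift (@shift_aug_subproof x).

Lemma shift_aug_funE x b : shift_aug_fun x (to_coker (rsaug R) x b) = rsd R 0 x b.
Proof. exact: quotliftE. Qed.

Definition shift_aug : sysmor C (R 1).
Proof.
exists shift_aug_fun => x y h q; have [b ->] := to_coker_surj q.
by rewrite -smor_nat !shift_aug_funE smor_nat.
Defined.

Lemma shift_mono : sysmor_mono shift_aug.
Proof.
move=> x; apply: raddf_inj => q; have [b ->] := to_coker_surj q.
by rewrite [shift_aug x _]shift_aug_funE => /rs_exact0 h; apply/to_coker_eq0.
Qed.

Lemma shift_exact0 x a : rsd R 1 x a = 0 <-> exists b, a = shift_aug x b.
Proof.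
rewrite rs_exactS; split=> -[b ->].
  by exists (to_coker _ x b); exact/esym/shift_aug_funE.
by have [c ->] := to_coker_surj b; exists c; exact: shift_aug_funE.
Qed.

Definition shift_resolution : resolution C :=
  @Resolution _ _ C (fun n => R n.+1) shift_aug (fun n => rsd R n.+1)
    shift_mono shift_exact0 (fun n => @rs_exactS _ _ _ R n.+1).

Lemma aug_exact : short_exact (rsaug R) (to_coker (rsaug R)).
Proof. exact/to_coker_exact/rs_mono. Qed.

(** By left exactness of lim, the threads of [R 1] killed by the differential are the threads of the
    cokernel of the augmentation; exactness says that these lift to [R 0]. *)
Lemma lim_exact0 : lim_exact R 0 <-> lim_surj (to_coker (rsaug R)).
Proof.
split=> [ER t|lp t dt].
  have [|u tu] := ER (syslim_map shift_aug t).
    apply: syslimP => x; rewrite !syslim_mapE.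
    by apply/shift_exact0; exists (val t x).
  exists u; apply: syslimP => x; apply: shift_mono.
  rewrite -syslim_mapE tu !syslim_mapE; exact/esym/shift_aug_funE.
have /dep_choice[c tc] x : exists c, val t x = shift_aug x c.
  by apply/shift_exact0; rewrite -syslim_mapE dt.
have cP : thread_prop (c : gprod C).
  by move=> x y h; apply: shift_mono; rewrite smor_nat -!tc syslim_thread.
have [u cu] := lp (mkthread cP); exists u; apply: syslimP => x.
rewrite tc (_ : c x = val (mkthread cP) x)// cu !syslim_mapE.
exact: shift_aug_funE.
Qed.
End Shift.

(** Dimension shifting: [shift_resolution] resolves the cokernel of the augmentation in one degree
    less, and acyclicity passes between this cokernel and [G] because [R 0] is acyclic. *)
Lemma acyc_resolution s G (R : resolution G) :
  (forall n k, acyc k (R n)) -> lim_exact R s <-> acyc s G.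
Proof.
elim: s G R => [|s IH] G R aR.
  rewrite lim_exact0; split=> [lp|aG].
    exact: (lim_surj_acyc1 (aug_exact R) lp (aR 0%N 0%N)).
  exact: (acyc1_lim_surj (aug_exact R) aG).
have -> : lim_exact R s.+1 <-> lim_exact (shift_resolution R) s by [].
rewrite IH; last by move=> n; exact: aR.
split=> [aC|aG]; first exact: (acyc_sub (aug_exact R) aC (aR _ _)).
exact: (acyc_quotient (aug_exact R) (aR _ _) aG).
Qed.

Lemma lim_exact_cohomology G (R : resolution G) s :
  lim_exact R s <-> forall c : cohomology (lim_complex R) s.+1, c = 0.
Proof.
split=> [ER c|H0 t dt].
  rewrite -[c]quotpi_reprK; apply/quotpi_eq0/mksubP; apply: ER.
  exact: (@cocycleP (lim_complex R) s.+1).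
have tz : (t : lim_complex R s.+1) \in kerg (cxd (lim_complex R) s.+1) by apply/kergP.
have /quotpi_eq0/mksubP := H0 (quotpi _ (sgproj tz)); exact.
Qed.

Lemma Rlim_eq0 s G : (forall c : Rlim s.+1 G, c = 0) <-> acyc s G.
Proof.
rewrite -lim_exact_cohomology; apply: acyc_resolution => n k.
exact/acyc_injective/the_resolution_injective.
Qed.
End ShortExact.

(** * Pullbacks and sums of towers *)

Section AdjointPullback.
Variables (d d' : Order.disp_t) (P : porderType d) (Q : porderType d').
Variables (e : P -> Q) (l : Q -> P).
Hypotheses (e_homo : {homo e : x y / (x <= y)%O}) (l_homo : {homo l : x y / (x <= y)%O}).
Hypotheses (unit_le : forall y, (y <= e (l y))%O) (counit_le : forall x, (l (e x) <= x)%O).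

Section Transpose.
Variables (F : invsys P) (J : invsys Q) (f : sysmor F (pullback e_homo J)).

Definition transpose_fun y : {additive pullback l_homo F y -> J y} :=
  bond J (unit_le y) \o f (l y).

Definition transpose : sysmor (pullback l_homo F) J.
Proof.
exists transpose_fun => x y h a /=.
rewrite smor_nat /= (bond_comp _ _ (le_trans h (unit_le y))).
by rewrite (bond_comp _ _ (le_trans h (unit_le y))).
Defined.
End Transpose.

(* Pulling back along [l] is an exact left adjoint of pulling back along [e]. *)
Lemma pullback_injective (J : invsys Q) :
  injective_sys J -> injective_sys (pullback e_homo J).
Proof.
move=> injJ F G i f mi.
have [k ki] := injJ _ _ (pullback_mor l_homo i) (transpose f) (fun y => mi (l y)).
pose g x : {additive G x -> pullback e_homo J x} := k (e x) \o bond G (counit_le x).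
have g_nat x y (h : (x <= y)%O) a :
    g x (bond G h a) = bond (pullback e_homo J) h (g y a).
  rewrite /= -(smor_nat k) /=; congr (k _ _).
  by rewrite !(bond_comp _ _ (le_trans (counit_le x) h)).
exists (@SysMor _ _ G (pullback e_homo J) g g_nat) => x a /=.
rewrite -(smor_nat i); rewrite [LHS]ki /= smor_nat /=.
by rewrite (bond_comp _ _ (lexx _)) bond_id.
Qed.

Lemma lim_pullback_inj (G : invsys Q) : injective (lim_pullback e_homo G).
Proof.
move=> s t st; apply: syslimP => y.
rewrite -(syslim_thread s (unit_le y)) -(syslim_thread t (unit_le y)).
by have := congr1 (fun u => val u (l y)) st => /= ->.
Qed.

(** A thread extends to [Q] by sending its value at [l y] down along [y <= e (l y)]. *)
Lemma lim_pullback_surj (G : invsys Q) (s : syslim (pullback e_homo G)) :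
  exists t, s = lim_pullback e_homo G t.
Proof.
have tP : thread_prop ((fun y => bond G (unit_le y) (val s (l y))) : gprod G).
  move=> x y h; rewrite -(syslim_thread s (l_homo h)) /=.
  by rewrite !(bond_comp _ _ (le_trans h (unit_le y))).
exists (mkthread tP); apply: syslimP => x /=.
rewrite -(syslim_thread s (counit_le x)) /= (bond_comp _ _ (lexx _)).
by rewrite bond_id.
Qed.

(** An injective resolution pulls back to an injective resolution with an isomorphic limit
    complex. *)
Lemma acyc_pullback s (G : invsys Q) : acyc s G -> acyc s (pullback e_homo G).
Proof.
pose R := the_resolution G.
have injR n : injective_sys (R n) by exact: the_resolution_injective.
rewrite -(@acyc_resolution _ _ _ _ R); last by move=> n k; exact: acyc_injective.
rewrite -(@acyc_resolution _ _ _ _ (pullback_resolution e_homo R)); last first.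
  by move=> n k; apply/acyc_injective/pullback_injective.
move=> ER t; have [t' ->] := lim_pullback_surj t; move=> dt.
have [|u ->] := ER t'.
  apply: (lim_pullback_inj (G := R s.+2)); rewrite raddf0 -[RHS]dt.
  exact: syslimP.
by exists (lim_pullback e_homo (R s) u); apply: syslimP.
Qed.
End AdjointPullback.

Section Increasing.
Variable f : nat -> nat.
Hypothesis f_incr : {homo f : j k / (j < k)%N}.

Lemma incr_homo : {homo f : j k / (j <= k)%O}.
Proof.
by move=> j k; rewrite !leEnat leq_eqVlt => /orP[/eqP->//|/f_incr/ltnW].
Qed.

Lemma incr_ge k : (k <= f k)%N.
Proof. by elim: k => // k IH; apply: leq_ltn_trans IH _; exact: f_incr. Qed.

Lemma incr_ex m : exists k, (m <= f k)%N.
Proof. by exists m; exact: incr_ge. Qed.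

Definition free_tower : invsys nat := pullback incr_homo zpow.
End Increasing.

Section OmegaMap.
Variable kappa : choiceType.

Section Map.
Variables (G H : Omega_system kappa) (f : forall alpha, sysmor (G alpha) (H alpha)).

Definition omega_map : sysmor (omega_sys G) (omega_sys H).
Proof.
exists (fun x => gsum_map (fun alpha => f alpha (x alpha))) => x y h a.
by apply: gsumP => alpha; rewrite /= smor_nat.
Defined.

Lemma omega_mapE x (a : omega_sys G x) alpha :
  val (omega_map x a) alpha = f alpha (x alpha) (val a alpha).
Proof. by []. Qed.
End Map.

Definition mkgsum (I : choiceType) (A : I -> zmodType) (a : gprod A)
    (aP : finsupp_prop a) : gsum A :=
  sgproj ((mksubP (@finsupp0 _ A) (@finsuppB _ A) a).2 aP).

Lemma omega_map_exact (F G H : Omega_system kappa)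
    (i : forall alpha, sysmor (F alpha) (G alpha))
    (p : forall alpha, sysmor (G alpha) (H alpha)) :
  (forall alpha, short_exact (i alpha) (p alpha)) ->
  short_exact (omega_map i) (omega_map p).
Proof.
move=> eip; split=> [x a b ab|x b|x c].
- apply: gsumP => alpha; have [mi _ _] := eip alpha; apply: mi.
  by rewrite -!omega_mapE ab.
- split=> [pb|[a ->]]; last first.
    by apply: gsumP => alpha; have [_ ep _] := eip alpha; apply/ep; exists (val a alpha).
  have /dep_choice[a ba] alpha : exists a, val b alpha = i alpha (x alpha) a.
    by have [_ ep _] := eip alpha; apply/ep; rewrite -omega_mapE pb.
  have aP : finsupp_prop (a : gprod (fun alpha => F alpha (x alpha))).
    apply: sub_finite_set (gsum_finite b) => alpha /= aN0 b0; apply: aN0.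
    have [mi _ _] := eip alpha; by apply: mi; rewrite -ba raddf0; exact: b0.
  by exists (mkgsum aP); apply: gsumP => alpha; rewrite ba omega_mapE.
(* Zero components are lifted to zero, so that the lift has finite support. *)
have /dep_choice[b bc] alpha : exists b, val c alpha = p alpha (x alpha) b /\
    (val c alpha = 0 -> b = 0).
  have [_ _ sp] := eip alpha; case: (pselect (val c alpha = 0)) => [c0|c0].
    by exists 0; split=> //; rewrite raddf0.
  by have [b cb] := sp _ (val c alpha); exists b; split.
have bP : finsupp_prop (b : gprod (fun alpha => G alpha (x alpha))).
  apply: sub_finite_set (gsum_finite c) => alpha /= bN0 c0; apply: bN0.
  exact: (bc alpha).2.
by exists (mkgsum bP); apply: gsumP => alpha; rewrite (bc alpha).1 omega_mapE.
Qed.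

Lemma acyc_free_towers s (f : kappa -> nat -> nat)
    (f_incr : forall alpha, {homo f alpha : j k / (j < k)%N}) :
  acyc s (omega_sys (A_system kappa)) ->
  acyc s (omega_sys (fun alpha => free_tower (f_incr alpha))).
Proof.
pose e (x : kappa -> nat) : kappa -> nat := fun alpha => f alpha (x alpha).
(* The left adjoint of [e]: in each coordinate the least [k] with [x alpha <= f alpha k]. *)
pose l (x : kappa -> nat) : kappa -> nat :=
  fun alpha => ex_minn (incr_ex (f_incr alpha) (x alpha)).
have e_homo : {homo e : x y / (x <= y)%O}.
  by move=> x y /lefP h; apply/lefP => alpha; apply: (incr_homo (f_incr alpha)); exact: h.
have l_homo : {homo l : x y / (x <= y)%O}.
  move=> x y /lefP h; apply/lefP => alpha; rewrite /l leEnat.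
  case: ex_minnP => j _ jmin; case: ex_minnP => k kge _; apply: jmin.
  by apply: leq_trans kge; have := h alpha; rewrite leEnat.
have unit_le y : (y <= e (l y))%O.
  by apply/lefP => alpha; rewrite /e /l; case: ex_minnP.
have counit_le x : (l (e x) <= x)%O.
  by apply/lefP => alpha; rewrite /e /l; case: ex_minnP => j _; exact.
move=> /(acyc_pullback e_homo l_homo unit_le counit_le).
pose F := omega_sys (fun alpha => free_tower (f_incr alpha)).
pose G := pullback e_homo (omega_sys (A_system kappa)).
(* [F] and [G] have the same groups, and their bonding maps differ only in the order proofs inside;
   identity maps carry acyclicity over. *)
have FG x y (h : (x <= y)%O) a : bond F h a = bond G h a.
  by apply: gsumP => alpha; apply/rowP => i; rewrite !mxE; congr (_ _ _); exact: val_inj.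
apply: (@acyc_retract _ _ _ F G
  (@SysMor _ _ F G (fun x => idfun) FG)
  (@SysMor _ _ G F (fun x => idfun) (fun x y h a => esym (FG x y h a)))).
by [].
Qed.
End OmegaMap.

(** * Finitely generated groups *)

Section Combinations.
Variable A : zmodType.
Implicit Types (s : seq A) (c : nat -> int).

(** Coefficients are a function on all of [nat], read only below [size s]; concatenating lists then
    merely shifts indices. *)
Definition comb s c : A := \sum_(0 <= i < size s) s`_i *~ c i.

Lemma eq_comb s c c' : (forall i, (i < size s)%N -> c i = c' i) -> comb s c = comb s c'.
Proof. by move=> cc; apply: eq_big_nat => i /andP[_ /cc->]. Qed.

Lemma comb_cat s s' c :
  comb (s ++ s') c = comb s c + comb s' (fun i => c (size s + i)%N).
Proof.
rewrite /comb size_cat (big_cat_nat _ (n := size s))//= ?leq_addr//; congr (_ + _).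
  by apply: eq_big_nat => i /andP[_ h]; rewrite nth_cat h.
rewrite -[X in \sum_(X <= _ < _) _]add0n big_addn addKn.
apply: eq_bigr => i _; rewrite nth_cat addnC -ltn_subRL subnn ltn0.
by rewrite addKn.
Qed.

Lemma combB s c c' : comb s (fun i => c i - c' i) = comb s c - comb s c'.
Proof. by rewrite /comb -sumrB; apply: eq_bigr => i _; rewrite mulrzBr. Qed.

Lemma comb0 s : comb s (fun=> 0) = 0.
Proof. by rewrite /comb big1// => i _; rewrite mulr0z. Qed.

Lemma comb_delta s j : (j < size s)%N -> comb s (fun i => (i == j)%:Z) = s`_j.
Proof.
move=> js; rewrite /comb big_mkord (bigD1 (Ordinal js))//= eqxx mulr1z.
rewrite big1 ?addr0// => i ij; have /negPf -> : nat_of_ord i != j by [].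
exact: mulr0z.
Qed.

Lemma comb1 a c : comb [:: a] c = a *~ c 0%N.
Proof. by rewrite /comb big_nat1. Qed.

Lemma comb_closed (H : A -> Prop) s c : H 0 -> (forall a b, H a -> H b -> H (a - b)) ->
  (forall a, a \in s -> H a) -> H (comb s c).
Proof.
move=> H0 HB Hs; have HN a : H a -> H (- a) by rewrite -sub0r; exact: HB.
have HD a b : H a -> H b -> H (a + b).
  by move=> Ha /HN Hb; rewrite -[b]opprK; exact: HB.
have Hn a (n : nat) : H a -> H (a *+ n).
  by move=> Ha; elim: n => // n IH; rewrite mulrS; exact: HD.
have HZ a (z : int) : H a -> H (a *~ z).
  by case: z => n Ha; [exact: Hn|rewrite NegzE mulrNz; exact/HN/Hn].
rewrite /comb big_mkord; elim/big_ind: _ => // i _; apply/HZ/Hs/mem_nth; exact: ltn_ord.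
Qed.

Definition generates (H : A -> Prop) s :=
  (forall a, a \in s -> H a) /\ forall a, H a -> exists c, a = comb s c.

Definition independent s :=
  forall c, comb s c = 0 -> forall i, (i < size s)%N -> c i = 0.
End Combinations.

Lemma comb_map (A B : zmodType) (f : {additive A -> B}) s c :
  comb (map f s) c = f (comb s c).
Proof.
rewrite /comb size_map raddf_sum; apply: eq_big_nat => i /andP[_ h].
by rewrite (nth_map 0)// raddfMz.
Qed.

(* The subgroup of elements with vanishing last coordinate has a basis by
   induction; it is completed by an element with least positive last coordinate. *)
Lemma subgroup_basis (A : zmodType) (x : nat -> {additive A -> int}) m (H : A -> Prop) :
  H 0 -> (forall a b, H a -> H b -> H (a - b)) ->
  (forall a, H a -> (forall i, (i < m)%N -> x i a = 0) -> a = 0) ->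
  exists2 s, generates H s & independent s.
Proof.
elim: m H => [|m IH] H H0 HB Hx.
  exists [::]; last by [].
  split=> // a /Hx -> //; exists (fun=> 0); by rewrite comb0.
have [||| s [sH sgen] sind] := IH (fun a => H a /\ x m a = 0).
- by rewrite raddf0.
- by move=> a b [Ha ma] [Hb mb]; split; [exact: HB|rewrite raddfB ma mb subrr].
- move=> a [Ha ma] ax; apply: Hx => // i; rewrite ltnS leq_eqVlt => /orP[/eqP->//|].
  exact: ax.
pose T n := (0 < n)%N && `[< exists2 a, H a & x m a = n%:Z >].
case: (pselect (exists n, T n)) => [exT|nT]; last first.
  have xm0 a : H a -> x m a = 0.
    move=> Ha; apply: contrapT => /eqP xa; apply: nT; exists `|x m a|%N.
    rewrite /T absz_gt0 xa; apply/asboolP.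
    case E : (x m a) => [n|n]; first by exists a.
    by exists (0 - a); [exact: HB|rewrite raddfB raddf0 E NegzE sub0r opprK].
  exists s => //; split=> a; first by move=> /sH[].
  by move=> Ha; apply: sgen; split=> //; exact: xm0.
case: (ex_minnP exT) => n /andP[n0 /asboolP[w Hw xw]] nmin.
have wZ (q : int) : H (w *~ q).
  by rewrite -[_ *~ _](comb1 w (fun=> q)); apply: comb_closed => // a; rewrite inE => /eqP->.
exists (s ++ [:: w]).
  split=> a; first by rewrite mem_cat inE => /orP[/sH[]//|/eqP->].
  move=> Ha; pose q := (x m a %/ n%:Z)%Z; pose r := (x m a %% n%:Z)%Z.
  have aq : x m (a - w *~ q) = r.
    rewrite raddfB raddfMz xw {1}(divz_eq (x m a) n%:Z) -/q -/r -mulrzr intz mulrC.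
    by rewrite addrC addKr.
  have r0 : r = 0.
    have rge0 : (0 <= r)%R by apply: modz_ge0; rewrite eqz_nat -lt0n.
    have rlt : (r < n%:Z)%R by apply: ltz_pmod; rewrite ltz_nat.
    case: r aq rge0 rlt => // r aq _; rewrite ltz_nat => rn.
    case: (posnP r) => [-> //|rgt0]; suff /nmin : T r by rewrite leqNgt rn.
    by rewrite /T rgt0; apply/asboolP; exists (a - w *~ q) => //; exact: HB.
  have [|c ac] := sgen (a - w *~ q); first by split; [exact: HB|rewrite aq].
  exists (fun i => if (i < size s)%N then c i else q).
  rewrite comb_cat comb1 addn0 ltnn.
  by rewrite (eq_comb (c' := c)) -?ac ?subrK// => i ->.
move=> c; rewrite comb_cat comb1 addn0 => cs.
have xs : x m (comb s (fun i => c i)) = 0.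
  apply: (comb_closed (H := fun a => x m a = 0)) => [|a b xa xb|a /sH[]//].
    exact: raddf0.
  by rewrite raddfB xa xb subrr.
have cl : c (size s) = 0.
  have := congr1 (x m) cs; rewrite raddfD xs add0r raddfMz xw raddf0 => /eqP.
  by rewrite -mulrzr intz mulf_eq0 => /orP[/eqP[nz]|/eqP//]; rewrite nz in n0.
move=> i; rewrite size_cat /= addn1 ltnS leq_eqVlt => /orP[/eqP->//|].
by apply: sind; move: cs; rewrite cl mulr0z addr0.
Qed.

Section Coordinates.
Variable m : nat.
Implicit Types v w : 'rV[int]_m.

(* Coordinates beyond [m] are [0]. *)
Definition vcoord (i : nat) v : int := if insub i is Some j then v ord0 j else 0.

Lemma vcoordE v (i : 'I_m) : vcoord i v = v ord0 i.
Proof. by rewrite /vcoord valK. Qed.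

Lemma vcoord_morph i : {morph vcoord i : v w / v - w}.
Proof. by move=> v w; rewrite /vcoord; case: insub => [j|]; rewrite ?mxE ?subr0. Qed.

Definition vcoord_add i : {additive 'rV[int]_m -> int} := mkadd (vcoord_morph i).

Lemma vcoord_inj v w : (forall i, (i < m)%N -> vcoord i v = vcoord i w) -> v = w.
Proof. by move=> vw; apply/rowP => i; rewrite -!vcoordE vw. Qed.

Definition mkrow (c : nat -> int) : 'rV[int]_m := \row_i c i.

Lemma vcoord_mkrow c i : (i < m)%N -> vcoord i (mkrow c) = c i.
Proof. by move=> im; rewrite -[i]/(val (Ordinal im)) vcoordE mxE. Qed.

Lemma row_comb_morph (A : zmodType) (s : seq A) :
  {morph (fun v => comb s (vcoord^~ v)) : v w / v - w}.
Proof.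
by move=> v w /=; rewrite -combB; apply: eq_comb => i _; exact: vcoord_morph.
Qed.

Definition row_comb (A : zmodType) (s : seq A) : {additive 'rV[int]_m -> A} :=
  mkadd (row_comb_morph s).
End Coordinates.

Lemma vcoord_zproj j k (h : (k <= j)%O) (v : 'rV[int]_j) i :
  (i < k)%N -> vcoord i (zproj h v) = vcoord i v.
Proof.
move=> ik; rewrite -[i]/(val (Ordinal ik)) vcoordE mxE.
by rewrite -vcoordE.
Qed.

Lemma fin_genP (A : zmodType) :
  fin_gen A <-> exists s : seq A, generates (fun=> True) s.
Proof.
split=> [[m [v vgen]]|[s [_ sgen]]].
  exists (map v (enum 'I_m)); split=> // a _; have [c ->] := vgen a.
  exists (fun i => if insub i is Some j then c j else 0).
  rewrite /comb size_map size_enum_ord big_mkord; apply: eq_bigr => i _.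
  by rewrite valK (nth_map i) ?size_enum_ord// nth_ord_enum.
exists (size s), (fun i => s`_i) => a; have [c ->] := sgen a Logic.I.
by exists (fun i => c i); rewrite /comb big_mkord.
Qed.

(** The preimage of [H] under a surjection from some Z^m has a basis by [subgroup_basis], and the
    images of its members generate [H]. *)
Lemma fin_gen_subgroup (A : zmodType) (H : A -> Prop) : fin_gen A ->
  H 0 -> (forall a b, H a -> H b -> H (a - b)) -> exists s, generates H s.
Proof.
move=> /fin_genP[s [_ sgen]] H0 HB.
pose h := @row_comb (size s) _ s.
have [|||w [wH wgen] _] := @subgroup_basis _ (@vcoord_add (size s)) (size s) (H \o h).
- by rewrite /comp raddf0.
- by move=> a b Ha Hb; rewrite /comp raddfB; exact: HB.
- by move=> v _ v0; apply: vcoord_inj => i im; rewrite [LHS]v0//; exact/esym/(raddf0 (vcoord_add _ i)).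
exists (map h w); split=> [_ /mapP[v /wH Hv ->]//|a Ha].
have [c ac] := sgen a Logic.I.
have ha : a = h (mkrow _ c).
  by rewrite ac; apply: eq_comb => i /vcoord_mkrow ->.
have [|e he] := wgen (mkrow _ c); first by rewrite /comp -ha.
by exists e; rewrite comb_map -he.
Qed.

Lemma fin_gen_image (A B : zmodType) (f : {additive A -> B}) :
  (forall b, exists a, b = f a) -> fin_gen A -> fin_gen B.
Proof.
move=> sf /fin_genP[s [_ sgen]]; apply/fin_genP; exists (map f s); split=> // b _.
have [a ->] := sf b; have [c ->] := sgen a Logic.I.
by exists c; rewrite comb_map.
Qed.

Lemma fin_gen_extension (A B C : zmodType) (i : {additive A -> B}) (p : {additive B -> C}) :
  (forall b, p b = 0 -> exists a, b = i a) -> (forall c, exists b, c = p b) ->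
  fin_gen A -> fin_gen C -> fin_gen B.
Proof.
move=> ep sp /fin_genP[s [_ sgen]] /fin_genP[w [_ wgen]].
have [q qp] : exists q : C -> B, forall c, p (q c) = c.
  by have [q qp] := dep_choice sp; exists q.
apply/fin_genP; exists (map q w ++ map i s); split=> // b _.
have [c bc] := wgen (p b) Logic.I.
have [|a ba] := ep (b - comb (map q w) c).
  rewrite raddfB -comb_map -map_comp (eq_map (_ : p \o q =1 id)) ?map_id ?bc ?subrr//.
have [e ae] := sgen a Logic.I.
exists (fun j => if (j < size w)%N then c j else e (j - size w)%N).
rewrite comb_cat size_map (eq_comb (c' := c)); last by move=> j; rewrite size_map => ->.
rewrite (eq_comb (s := map i s) (c' := e)); last first.
  by move=> j _; rewrite ltnNge leq_addr /= addKn.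
by rewrite comb_map -ae -ba addrC subrK.
Qed.

(** * Towers *)

Lemma dep_rec (X : nat -> Type) (R : forall n, X n -> X n.+1 -> Prop) : X 0%N ->
  (forall n x, exists y, R n x y) -> exists f : forall n, X n, forall n, R n (f n) (f n.+1).
Proof.
move=> x0 step; exists (nat_rect X x0 (fun n x => sval (cid (step n x)))) => n /=.
by case: cid.
Qed.

Section Towers.
Implicit Types T : invsys nat.

Lemma leSn k : (k <= k.+1)%O. Proof. by rewrite leEnat. Qed.

Definition onto_tower T := forall k (t : T k), exists u, t = bond T (leSn k) u.

Lemma thread_nat T (a : gprod T) :
  (forall k, bond T (leSn k) (a k.+1) = a k) -> thread_prop a.
Proof.
move=> aS j k; elim: k j => [|k IH] j h.
  by case: j h => // h; exact: bond_id.
have [jk|jk] := eqVneq j k.+1; first by subst j; exact: bond_id.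
have jk' : (j <= k)%O by move: h; rewrite !leEnat leq_eqVlt (negPf jk).
by rewrite -(bond_comp jk' (leSn k) h) aS IH.
Qed.

(** The onto case of the Mittag-Leffler criterion: [e] is chosen recursively to bound [g] on
    successive levels, and the cocycle identity extends this to all pairs. *)
Lemma acyc1_onto T : onto_tower T -> acyc1 T.
Proof.
move=> oT g cg.
have [|k a|e eE] := @dep_rec (fun k => T k) (fun k a b => g k k.+1 (leSn k) = bond T (leSn k) b - a).
- exact: 0.
- have [b ab] := oT k (g k k.+1 (leSn k) + a).
  by exists b; rewrite -ab addrK.
exists e => j k; elim: k j => [|k IH] j h; last have [jk|jk] := eqVneq j k.+1.
(* At equal indices the cocycle identity forces [g] to vanish. *)
- case: j h => // h; rewrite bond_id subrr.
  by have := cg _ _ _ h h h; rewrite bond_id -[LHS]add0r => /addIr.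
- subst j; rewrite bond_id subrr.
  by have := cg _ _ _ h h h; rewrite bond_id -[LHS]add0r => /addIr.
have jk' : (j <= k)%O by move: h; rewrite !leEnat leq_eqVlt (negPf jk).
rewrite (cg _ _ _ jk' (leSn k) h) IH eE raddfB (bond_comp _ _ h).
by rewrite [LHS]addrC addrA subrK.
Qed.

Definition coind_extend (A : nat -> zmodType) k (t : coind A k) : coind A k.+1 :=
  fun z => match pselect (sval z <= k)%O return A (sval z) with
    left h => t (exist _ (sval z) h) | right _ => 0 end.

Lemma coind_onto (A : nat -> zmodType) : onto_tower (coind A).
Proof.
move=> k t; exists (coind_extend t).
apply: gprodP => -[z zk]; rewrite (coind_bondE _ _ _ (le_trans zk (leSn k))).
rewrite /coind_extend /=.
by case: pselect => // h; rewrite (bool_irrelevance h zk).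
Qed.

Lemma onto_quotient F G (p : sysmor F G) :
  (forall k c, exists b, c = p k b) -> onto_tower F -> onto_tower G.
Proof.
move=> sp oF k c; have [b ->] := sp _ c; have [b' ->] := oF k b.
by exists (p k.+1 b'); rewrite smor_nat.
Qed.

Lemma cosyz_onto T : onto_tower (cosyz T).
Proof. by apply: (onto_quotient _ (@coind_onto T)) => k c; exact: to_coker_surj. Qed.

(** The cosyzygy of every tower is onto, so derived limits of towers vanish from degree 2 on. *)
Lemma acycS_tower s T : acyc s.+1 T.
Proof. by elim: s T => [|s IH] T; [exact/acyc1_onto/cosyz_onto|exact: IH]. Qed.

Lemma thread_extension T k (t : T k) : onto_tower T -> exists s : syslim T, val s k = t.
Proof.
(* Only the levels up to [k] are tied to [t]; above [k] any lift along the bonding map will do. *)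
move=> oT; pose X j := {a : T j | forall h : (j <= k)%O, a = bond T h t}.
have [|j [a ak]|e eE] := @dep_rec X (fun j a b => bond T (leSn j) (sval b) = sval a).
- have h0 : (0%N <= k)%O by rewrite leEnat.
  by exists (bond T h0 t) => h; congr (bond _ _ _); exact: bool_irrelevance.
- case: (pselect (j.+1 <= k)%O) => [h|nh].
    have bP h' : bond T h t = bond T h' t by congr (bond _ _ _); exact: bool_irrelevance.
    exists (exist _ (bond T h t) bP) => /=.
    by rewrite (ak (le_trans (leSn j) h)) (bond_comp _ _ (le_trans (leSn j) h)).
  have [b ab] := oT j a.
  have bP (h' : (j.+1 <= k)%O) : b = bond T h' t by [].
  by exists (exist _ b bP).
exists (mkthread (@thread_nat T (fun j => sval (e j)) eE)) => /=.
by case: (e k) => a /= ->; rewrite bond_id.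
Qed.

Definition thread_val T k : {additive syslim T -> T k} :=
  mkadd (fun s t : syslim T => erefl (val (s - t) k)).

(** The kernel of the map from level [k] to the level before it, where the level before 0 is read as
    the zero group. *)
Definition level_ker T k : T k -> Prop :=
  match k return T k -> Prop with
  | 0%N => fun=> True
  | j.+1 => fun a => bond T (leSn j) a = 0
  end.

Lemma level_ker0 T k : level_ker (0 : T k).
Proof. by case: k => //= k; rewrite raddf0. Qed.

Lemma level_kerB T k (a b : T k) : level_ker a -> level_ker b -> level_ker (a - b).
Proof. by case: k a b => //= k a b; rewrite raddfB => -> ->; rewrite subrr. Qed.

(** * Maps from free towers given by lists of threads *)

Section Adapted.
Variables (T : invsys nat) (L : nat -> seq (syslim T)).
Hypothesis L_ker : forall k s, s \in L k -> level_ker (thread_val T k s).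
Hypothesis L_gt0 : forall k, (0 < size (L k))%N.

(** The generators at level [k] are the threads in the lists up to [k]. Those of [L j] vanish below
    level [j], so dropping later coordinates agrees with the bonding maps of [T]. *)
Fixpoint prefix k := if k is j.+1 then prefix j ++ L k else L 0%N.

Definition rank k := size (prefix k).

Lemma rank_incr : {homo rank : j k / (j < k)%N}.
Proof.
apply: homo_ltn => [j k l|k]; first exact: ltn_trans.
by rewrite /rank /= size_cat -{1}[size _]addn0 ltn_add2l.
Qed.

Lemma prefix_split j k : (j <= k)%O -> exists2 w, prefix k = prefix j ++ w &
  forall s, s \in w -> thread_val T j s = 0.
Proof.
elim: k j => [|k IH] j h.
  by case: j h => // _; exists [::]; rewrite ?cats0.
have [->|jk] := eqVneq j k.+1; first by exists [::]; rewrite ?cats0.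
have jk' : (j <= k)%O by move: h; rewrite !leEnat leq_eqVlt (negPf jk).
have [w pw w0] := IH _ jk'; exists (w ++ L k.+1); first by rewrite /= pw catA.
move=> s; rewrite mem_cat => /orP[/w0//|/L_ker /= sk].
rewrite -(syslim_thread s jk') -(syslim_thread s (leSn k)).
by rewrite [X in bond T jk' X]sk raddf0.
Qed.

Lemma comb_vanish k (w : seq (syslim T)) c :
  (forall s, s \in w -> thread_val T k s = 0) -> thread_val T k (comb w c) = 0.
Proof.
move=> w0; apply: (comb_closed (H := fun s => thread_val T k s = 0)) => // a b ha hb.
by rewrite raddfB ha hb subrr.
Qed.

Definition adapted_fun k : {additive free_tower rank_incr k -> T k} :=
  thread_val T k \o @row_comb (rank k) _ (prefix k).

Definition coords k (v : free_tower rank_incr k) (i : nat) : int :=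
  @vcoord (rank k) i v.

Lemma adapted_funE k v : adapted_fun k v = thread_val T k (comb (prefix k) (coords v)).
Proof. by []. Qed.

Definition adapted : sysmor (free_tower rank_incr) T.
Proof.
exists adapted_fun => j k h v; rewrite !adapted_funE [RHS](syslim_thread _ h).
have [w pw w0] := prefix_split h; rewrite pw comb_cat [RHS](raddfD (thread_val T j)) (comb_vanish _ w0) addr0.
congr (thread_val _ _ _); apply: eq_comb => i ij.
exact: vcoord_zproj.
Defined.

Lemma adaptedE k v : adapted k v = thread_val T k (comb (prefix k) (coords v)).
Proof. by []. Qed.

Lemma adaptedS k v : adapted k.+1 v = thread_val T k.+1 (comb (prefix k) (coords v)) +
  thread_val T k.+1 (comb (L k.+1) (fun i => coords v (rank k + i)%N)).
Proof. by rewrite adaptedE -[prefix k.+1]/(prefix k ++ L k.+1) comb_cat raddfD. Qed.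

Definition row_cat k (c e : nat -> int) : free_tower rank_incr k.+1 :=
  mkrow (rank k.+1) (fun i => if (i < rank k)%N then c i else e (i - rank k)%N).

Lemma coords_row_cat k c e i : (i < rank k.+1)%N ->
  coords (row_cat k c e) i = if (i < rank k)%N then c i else e (i - rank k)%N.
Proof. exact: vcoord_mkrow. Qed.

Lemma coords_inj k (v w : free_tower rank_incr k) :
  (forall i, (i < rank k)%N -> coords v i = coords w i) -> v = w.
Proof. exact: vcoord_inj. Qed.

Lemma coords0 k i : coords (0 : free_tower rank_incr k) i = 0.
Proof. exact: (raddf0 (vcoord_add _ i)). Qed.

Lemma adapted_row_cat k c e : adapted k.+1 (row_cat k c e) =
  thread_val T k.+1 (comb (prefix k) c) + thread_val T k.+1 (comb (L k.+1) e).
Proof.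
rewrite adaptedS; congr (thread_val _ _ _ + thread_val _ _ _); apply: eq_comb => i ik.
  rewrite coords_row_cat ?ik//; apply: ltn_trans ik _; exact: rank_incr.
by rewrite coords_row_cat ?ltnNge ?leq_addr ?addKn// /rank /= size_cat -ltnNge ltn_add2l.
Qed.

Lemma coords_bond j k (h : (j <= k)%O) (v : free_tower rank_incr k) i :
  (i < rank j)%N -> coords (bond (free_tower rank_incr) h v) i = coords v i.
Proof. exact: vcoord_zproj. Qed.

Lemma row_cat_bond k e : bond (free_tower rank_incr) (leSn k) (row_cat k (fun=> 0) e) = 0.
Proof.
apply: coords_inj => i ik; rewrite coords_bond// coords_row_cat ?ik.
  by rewrite coords0.
by apply: ltn_trans ik _; exact: rank_incr.
Qed.

Lemma row_cat_bondK k (v : free_tower rank_incr k) e :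
  bond (free_tower rank_incr) (leSn k) (row_cat k (coords v) e) = v.
Proof.
apply: coords_inj => i ik; rewrite coords_bond// coords_row_cat ?ik//.
by apply: ltn_trans ik _; exact: rank_incr.
Qed.

(** In a kernel element at level [k.+1] the first [rank k] coordinates vanish by induction; the
    others are coefficients of a relation among the independent values of [L k.+1]. *)
Lemma adapted_inj :
  (forall k c, thread_val T k (comb (L k) c) = 0 -> forall i, (i < size (L k))%N -> c i = 0) ->
  sysmor_mono adapted.
Proof.
move=> Lind k; apply: raddf_inj; elim: k => [|k IH] v.
  rewrite adaptedE => /Lind v0; apply: coords_inj => i ik.
  by rewrite v0//; rewrite coords0.
move=> uv.
have bv : bond (free_tower rank_incr) (leSn k) v = 0.
  by apply: IH; rewrite smor_nat uv raddf0.
have v0 i : (i < rank k)%N -> coords v i = 0.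
  by move=> ik; have := coords_bond (leSn k) v ik; rewrite bv coords0.
move: uv; rewrite adaptedS (eq_comb (c' := fun=> 0))// comb0 raddf0 add0r => /Lind vk.
apply: coords_inj => i ik; rewrite coords0.
have [/v0//|ki] := ltnP i (rank k); rewrite -(subnKC ki) vk//.
by rewrite ltn_subLR// -size_cat.
Qed.

Hypothesis L_gen : forall k a, level_ker a -> exists c, a = thread_val T k (comb (L k) c).

(** New generators alone reach the level kernel. This drives the induction in [adapted_surj], and
    later shows that the tower of relations is onto. *)
Lemma adapted_lift k a : bond T (leSn k) a = 0 ->
  exists2 v, bond (free_tower rank_incr) (leSn k) v = 0 & a = adapted k.+1 v.
Proof.
move=> /(@L_gen k.+1)[c ->]; exists (row_cat k (fun=> 0) c); first exact: row_cat_bond.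
by rewrite adapted_row_cat comb0 raddf0 add0r.
Qed.

Lemma adapted_surj k a : exists v, a = adapted k v.
Proof.
elim: k a => [|k IH] a.
  have [c ->] := @L_gen 0%N a Logic.I; exists (mkrow _ c).
  rewrite adaptedE; congr (thread_val _ _ _); apply: eq_comb => i ik.
  exact/esym/vcoord_mkrow.
have [v av] := IH (bond T (leSn k) a).
have [|w _ aw] := @adapted_lift k (a - adapted k.+1 (row_cat k (coords v) (fun=> 0))).
  rewrite raddfB av -smor_nat -raddfB.
  by rewrite row_cat_bondK subrr raddf0.
by exists (w + row_cat k (coords v) (fun=> 0)); rewrite raddfD -aw subrK.
Qed.
End Adapted.
End Towers.

(** * Presentations of towers *)

Section KernelSystem.
Variables (d : Order.disp_t) (P : porderType d) (F G : invsys P) (p : sysmor F G).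

Definition ker_obj x : zmodType := subgrp (kerg (p x)).

Lemma ker_bond_subproof x y (h : (x <= y)%O) (a : ker_obj y) :
  bond F h (val a) \in kerg (p x).
Proof. by have /kergP pa := valP a; apply/kergP; rewrite smor_nat pa raddf0. Qed.

Lemma ker_bond_morph x y (h : (x <= y)%O) :
  {morph (fun a => sgproj (ker_bond_subproof h a)) : a b / a - b}.
Proof. by move=> a b; apply: val_inj; rewrite /= raddfB. Qed.

Definition ker_sys : invsys P.
Proof.
exists ker_obj (fun x y h => mkadd (@ker_bond_morph x y h)).
  by move=> x h a; apply: val_inj; rewrite /= bond_id.
by move=> x y z hxy hyz hxz a; apply: val_inj; rewrite /= (bond_comp _ _ hxz).
Defined.

Definition ker_incl : sysmor ker_sys F.
Proof. by exists (fun x => sgval (kerg (p x))). Defined.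

Lemma ker_incl_inj : sysmor_mono ker_incl.
Proof. by move=> x; exact: val_inj. Qed.

Lemma ker_inclP x b : p x b = 0 <-> exists a, b = ker_incl x a.
Proof.
split=> [pb|[a ->]]; first by have /kergP bK := pb; exists (sgproj bK).
by apply/kergP; exact: valP.
Qed.
End KernelSystem.

(** A free resolution of length one; strictly increasing ranks make [acyc_free_towers] applicable to
    both free terms. *)
Record presentation (T : invsys nat) := Presentation {
  pr_gens : nat -> nat;
  pr_rels : nat -> nat;
  pr_gens_incr : {homo pr_gens : j k / (j < k)%N};
  pr_rels_incr : {homo pr_rels : j k / (j < k)%N};
  pr_incl : sysmor (free_tower pr_rels_incr) (free_tower pr_gens_incr);
  pr_proj : sysmor (free_tower pr_gens_incr) T;
  pr_exact : short_exact pr_incl pr_proj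
}.

Section ThreadLists.
Variables (T : invsys nat) (oT : onto_tower T).

Definition lift k (a : T k) : syslim T := sval (cid (thread_extension a oT)).

Lemma liftK k (a : T k) : thread_val T k (lift a) = a.
Proof. exact: (svalP (cid (thread_extension a oT))). Qed.

Lemma thread_val_comb_lift k (s : seq (T k)) c :
  thread_val T k (comb (map (@lift k) s) c) = comb s c.
Proof.
rewrite -comb_map -map_comp; congr (comb _ _).
by rewrite -[RHS]map_id; apply: eq_map => a; exact: liftK.
Qed.
End ThreadLists.

(* The padding by a zero generator in each level makes the ranks of both the
   generators and the relations strictly increasing, hence cofinal in [nat]. *)
Lemma presentation_exists (T : invsys nat) :
  onto_tower T -> (forall k, fin_gen (T k)) -> exists pr : presentation T, True.
Proof.
move=> oT fT.
have /dep_choice[w wgen] k : exists w : seq (T k), generates (@level_ker T k) w.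
  exact: (fin_gen_subgroup (fT k) (@level_ker0 T k) (@level_kerB T k)).
pose L k := 0 :: map (@lift T oT k) (w k).
have L_ker k s : s \in L k -> level_ker (thread_val T k s).
  rewrite inE => /orP[/eqP->|/mapP[a aw ->]]; first by rewrite raddf0; exact: level_ker0.
  by rewrite liftK; exact: (wgen k).1.
have L_gt0 k : (0 < size (L k))%N by [].
have L_gen k a : level_ker a -> exists c, a = thread_val T k (comb (L k) c).
  (* Index 0 belongs to the padding thread, so the coefficients move up by one. *)
  move=> /(wgen k).2[c ->]; exists (fun i => c i.-1).
  by rewrite -[L k]/([:: 0] ++ map (@lift T oT k) (w k)) comb_cat comb1 mul0rz add0r thread_val_comb_lift.
pose p := adapted L_ker L_gt0; pose K := ker_sys p.
(* A lift [z] of [a] to the free tower need not be a relation, but [p z] lies in the level kernel.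
   Hence [adapted_lift] gives [v] above 0 with the same image, and [z - v] is a relation lifting
   [a]. *)
have oK : onto_tower K.
  move=> k a; pose z := row_cat L_gt0 k (coords (L_gt0 := L_gt0) (val a)) (fun=> 0).
  have bz : bond _ (leSn k) z = val a by exact: row_cat_bondK.
  have [|v bv zv] := @adapted_lift _ _ L_ker L_gt0 L_gen k (p k.+1 z).
    by rewrite -smor_nat bz; apply/ker_inclP; exists a.
  have /ker_inclP[b zb] : p k.+1 (z - v) = 0 by rewrite raddfB zv subrr.
  exists b; apply: val_inj; transitivity (bond _ (leSn k) (ker_incl p k.+1 b)).
    by rewrite -zb raddfB bz bv subr0.
  exact/esym/(smor_nat (ker_incl p) (leSn k)).
(* The basis vector of the padding thread is a nonzero relation in the level kernel; this keeps the
   bases chosen next nonempty. *)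
have K_neq0 k : exists2 a : K k, level_ker a & a <> 0.
  have [v vker [pv v0]] : exists2 v : free_tower (rank_incr L_gt0) k,
      level_ker v & p k v = 0 /\ v <> 0.
    case: k => [|k].
      exists (mkrow _ (fun i => (i == 0%N)%:Z)) => //; split.
        rewrite adaptedE (_ : comb _ _ = 0) ?raddf0//.
        transitivity ((L 0%N)`_0); last by [].
        rewrite -comb_delta//; apply: eq_comb => i ik; exact: vcoord_mkrow.
      move=> /(congr1 (fun v => coords (L_gt0 := L_gt0) v 0%N)).
      by rewrite coords0 [X in X = _]vcoord_mkrow.
    exists (row_cat L_gt0 k (fun=> 0) (fun i => (i == 0%N)%:Z)); first exact: row_cat_bond.
    split; first by rewrite adapted_row_cat comb0 raddf0 add0r comb_delta// raddf0.
    move=> /(congr1 (fun v => coords v (rank L k))).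
    by rewrite coords0 coords_row_cat ?ltnn ?subnn//; exact: rank_incr.
  have /ker_inclP[a va] := pv; exists a; last by move=> a0; apply: v0; rewrite va a0 raddf0.
  case: k a v vker va {pv v0} => //= k a v vker va; apply: val_inj.
  by move: vker; rewrite va.
(* [K k] embeds in Z^(rank k), so its level kernel has a basis; lifting these bases to threads makes
   [adapted] an isomorphism onto [K]. *)
have /dep_choice[s sP] k : exists s : seq (K k),
    [/\ generates (@level_ker K k) s, independent s & (0 < size s)%N].
  have [|||s sgen sind] := @subgroup_basis (K k)
    (fun i => vcoord_add (rank L k) i \o ker_incl p k) (rank L k) (@level_ker K k).
  - exact: level_ker0.
  - exact: level_kerB.
  - move=> a _ a0; apply: (@ker_incl_inj _ _ _ _ p); rewrite raddf0.
    by apply: coords_inj => i /a0 ai; rewrite coords0; exact: ai.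
  exists s; split=> //; case: s sgen {sind} => // -[_ s0].
  by have [a /s0[c ->]] := K_neq0 k; rewrite /comb big_nil.
pose M k := map (@lift K oK k) (s k).
have M_ker k a : a \in M k -> level_ker (thread_val K k a).
  by move=> /mapP[b bs ->]; rewrite liftK; have [[sker _] _ _] := sP k; exact: sker.
have M_gt0 k : (0 < size (M k))%N by rewrite size_map; have [] := sP k.
have M_gen k a : level_ker a -> exists c, a = thread_val K k (comb (M k) c).
  have [[_ sgen] _ _] := sP k.
  by move=> /sgen[c ->]; exists c; rewrite thread_val_comb_lift.
have M_ind k c : thread_val K k (comb (M k) c) = 0 ->
    forall i, (i < size (M k))%N -> c i = 0.
  rewrite thread_val_comb_lift size_map; have [_ sind _] := sP k; exact: sind.
have exi : short_exact (syscomp (ker_incl p) (adapted M_ker M_gt0)) p.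
  split=> [x a b /ker_incl_inj/(adapted_inj M_ind)//|x b|x c].
    rewrite ker_inclP; split=> -[a ->]; last by exists (adapted M_ker M_gt0 x a).
    by have [v ->] := adapted_surj M_ker M_gt0 M_gen a; exists v.
  exact: (adapted_surj L_ker L_gt0 L_gen).
by exists (Presentation exi).
Qed.

Section CoinducedFinGen.
Variable A : nat -> zmodType.

Definition coind_in_fun k (a : A k) : coind A k :=
  fun z => eqtype.dfwith (fun j => 0 : A j) a (sval z).

Lemma coind_in_morph k : {morph @coind_in_fun k : a b / a - b}.
Proof.
move=> a b; apply: gprodP => -[z zk]; rewrite gprodB /coind_in_fun /=.
have [<-|kz] := eqVneq k z; first by rewrite !eqtype.dfwith_in.
by rewrite !eqtype.dfwith_out// subr0.
Qed.

Definition coind_in k : {additive A k -> coind A k} := mkadd (@coind_in_morph k).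

(** Each step of the tower adds one factor, [A k.+1], which is the kernel of the bonding map. *)
Lemma coind_fin_gen : (forall k, fin_gen (A k)) -> forall k, fin_gen (coind A k).
Proof.
move=> fA; have inE k (t : coind A k) :
    (forall z, (sval z < k)%N -> t z = 0) -> exists a, t = coind_in k a.
  move=> t0; exists (t (exist _ k (lexx k))); apply: gprodP => -[z zk].
  rewrite /= /coind_in_fun /=; have [kz|kz] := eqVneq k z.
    by subst z; rewrite eqtype.dfwith_in; exact: coind_eq.
  rewrite eqtype.dfwith_out// t0//=.
  by move: zk; rewrite leEnat leq_eqVlt eq_sym (negPf kz).
elim=> [|k IH]; first by apply: fin_gen_image (fA 0%N) => t; exact: inE.
apply: (fin_gen_extension (i := coind_in k.+1) (p := bond (coind A) (leSn k))) => // t.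
  move=> t0; apply: inE => -[z zk] /= zk'.
  have := congr1 (fun s : coind A k => s (exist _ z zk')) t0.
  by rewrite (coind_bondE _ _ _ zk).
exact: coind_onto.
Qed.
End CoinducedFinGen.

Lemma cosyz_fin_gen (T : invsys nat) :
  (forall k, fin_gen (T k)) -> forall k, fin_gen (cosyz T k).
Proof.
move=> fT k; apply: fin_gen_image (coind_fin_gen fT k) => c; exact: to_coker_surj.
Qed.

(** * Acyclicity of sums of finitely generated towers *)

Section OmegaAcyclic.
Variables (kappa : choiceType) (n : nat).
Hypothesis acycA : forall s, (s <= n)%N -> acyc s (omega_sys (A_system kappa)).

(** One degree is lost because lim^(s+1) of the quotient is controlled by lim^(s+1) of the
    generators and lim^(s+2) of the relations. *)
Lemma acyc_omega_onto s (T : Omega_system kappa) : (s < n)%N ->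
  (forall alpha, onto_tower (T alpha)) -> (forall alpha k, fin_gen (T alpha k)) ->
  acyc s (omega_sys T).
Proof.
move=> sn oT fT.
have /dep_choice[pr _] alpha := presentation_exists (oT alpha) (fT alpha).
apply: (acyc_quotient (omega_map_exact (fun alpha => pr_exact (pr alpha)))).
  by apply: acyc_free_towers; apply: acycA; exact: ltnW.
by apply: acyc_free_towers; exact: acycA.
Qed.

Variable G : Omega_system kappa.
Hypothesis fG : forall alpha k, fin_gen (G alpha k).

Definition omega_coind : Omega_system kappa := fun alpha => coind (G alpha).
Definition omega_cosyz : Omega_system kappa := fun alpha => cosyz (G alpha).

Definition omega_to_coind : sysmor (omega_sys G) (omega_sys omega_coind) :=
  omega_map (fun alpha => to_coind (G alpha)).

Definition omega_to_cosyz : sysmor (omega_sys omega_coind) (omega_sys omega_cosyz) :=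
  omega_map (fun alpha => to_coker (to_coind (G alpha))).

Lemma omega_cosyz_exact : short_exact omega_to_coind omega_to_cosyz.
Proof. by apply: omega_map_exact => alpha; exact: cosyz_exact. Qed.

Lemma acyc_omega_coind s : (s < n)%N -> acyc s (omega_sys omega_coind).
Proof.
move=> sn; apply: acyc_omega_onto => // alpha; first exact: coind_onto.
exact: coind_fin_gen.
Qed.

(** Dimension shift along [omega_cosyz_exact], whose other two terms are sums of onto towers. *)
Lemma acycS_omega s : (s.+1 < n)%N -> acyc s.+1 (omega_sys G).
Proof.
move=> sn; apply: (acyc_sub omega_cosyz_exact); last exact: acyc_omega_coind.
apply: acyc_omega_onto => [|alpha|alpha]; [exact: ltnW|exact: cosyz_onto|].
exact: cosyz_fin_gen.
Qed.
End OmegaAcyclic.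

(** * Cocycle representatives *)

Section Representatives.
Variables (d : Order.disp_t) (P : porderType d).
Implicit Types F G : invsys P.

(** The augmentation identifies lim G with the 0-cocycles of the limit complex; [g] is the family
    corresponding to [t]. *)
Definition rep0 G (R : resolution G) (t : syslim (R 0)) (g : gprod G) :=
  forall x, val t x = rsaug R x (g x).

(* The connecting map of the resolution sends the class of the cocycle [g] to
   the class of [t]. *)
Definition rep1 G (R : resolution G) (t : syslim (R 1)) (g : cochain1 G) :=
  exists r : forall x, R 0 x, (forall x, val t x = rsd R 0 x (r x)) /\
    forall x y (h : (x <= y)%O), rsaug R x (g x y h) = bond (R 0) h (r y) - r x.

Lemma aug0_exact G (R : resolution G) x a : rsd R 0 x a = 0 -> exists b, a = rsaug R x b.
Proof. by move/rs_exact0. Qed.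

Lemma rep0_ex G (R : resolution G) (t : syslim (R 0)) : syslim_map (rsd R 0) t = 0 ->
  exists2 g, thread_prop g & rep0 t g.
Proof.
move=> dt; have /dep_choice[g tg] x : exists g, val t x = rsaug R x g.
  by apply/rs_exact0; rewrite -syslim_mapE dt.
exists g => // x y h; apply: (@rs_mono _ _ _ R).
by rewrite smor_nat -!tg syslim_thread.
Qed.

Lemma rep0_onto G (R : resolution G) g : thread_prop g ->
  exists2 t : syslim (R 0), syslim_map (rsd R 0) t = 0 & rep0 t g.
Proof.
move=> gP; exists (syslim_map (rsaug R) (mkthread gP)) => //.
by apply: syslimP => x; rewrite !syslim_mapE; apply/rs_exact0; exists (g x).
Qed.

Lemma rep1_ex G (R : resolution G) (t : syslim (R 1)) : syslim_map (rsd R 1) t = 0 ->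
  exists2 g, cocycle1 g & rep1 t g.
Proof.
move=> dt; have /dep_choice[r tr] x : exists r, val t x = rsd R 0 x r.
  by apply/rs_exactS; rewrite -syslim_mapE dt.
pose g : cochain1 (R 0) := fun x y h => bond (R 0) h (r y) - r x.
have [|x y h|a ca ga] := @lift_cocycle1 _ _ _ _ _ _ _ (aug_exact R) g.
- exact: (@bounds_cocycle _ _ _ _ r).
- apply/to_coker_eq0/rs_exact0; rewrite raddfB smor_nat -!tr syslim_thread.
  exact: subrr.
by exists a => //; exists r; split=> // x y h; rewrite -ga.
Qed.

Lemma rep1_onto G (R : resolution G) g : acyc1 (R 0%N) -> cocycle1 g ->
  exists2 t : syslim (R 1), syslim_map (rsd R 1) t = 0 & rep1 t g.
Proof.
move=> aR cg; have [r rg] := aR _ (cocycle1_map (rsaug R) cg).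
have tP : thread_prop ((fun x => rsd R 0 x (r x)) : gprod (R 1)).
  move=> x y h; rewrite -smor_nat; apply/eqP; rewrite -subr_eq0 -raddfB -rg.
  by apply/eqP/rs_exact0; exists (g x y h).
exists (mkthread tP); last by exists r.
by apply: syslimP => x; rewrite syslim_mapE /= rsdd.
Qed.

Lemma rep0B G (R : resolution G) (s t : syslim (R 0)) f g :
  rep0 s f -> rep0 t g -> rep0 (s - t) (f - g).
Proof. by move=> sf tg x; rewrite -[LHS]/(val s x - val t x) sf tg -raddfB. Qed.

Lemma rep1B G (R : resolution G) (s t : syslim (R 1)) f g :
  rep1 s f -> rep1 t g -> rep1 (s - t) (fun x y h => f x y h - g x y h).
Proof.
move=> [r [sr rf]] [q [tq qg]]; exists (fun x => r x - q x); split=> [x|x y h].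
  by rewrite -[LHS]/(val s x - val t x) sr tq raddfB.
by rewrite raddfB rf qg (raddfB (bond (R 0) h)); exact: subrACA.
Qed.

(** If [t] is the coboundary of [u], then [r - u] comes from a cochain of [G] that bounds [g];
    conversely, a cochain bounding [g] corrects [r] to a thread. *)
Lemma rep1_bounds G (R : resolution G) (t : syslim (R 1)) g :
  rep1 t g -> (exists u, t = syslim_map (rsd R 0) u) <-> exists e, bounds g e.
Proof.
move=> [r [tr rg]]; split=> [[u tu]|[e ge]].
  have /dep_choice[e er] x : exists e, r x - val u x = rsaug R x e.
    by apply: aug0_exact; rewrite raddfB -tr tu syslim_mapE subrr.
  exists e => x y h; apply: (@rs_mono _ _ _ R).
  by rewrite rg raddfB smor_nat -!er raddfB subrACA syslim_thread subrr subr0.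
have uP : thread_prop ((fun x => r x - rsaug R x (e x)) : gprod (R 0)).
  move=> x y h; apply/eqP; rewrite -subr_eq0 raddfB subrACA -rg ge raddfB -smor_nat.
  by rewrite subrr.
exists (mkthread uP); apply: syslimP => x; rewrite syslim_mapE /= raddfB tr.
by rewrite [X in _ - X](_ : _ = 0) ?subr0//; apply/rs_exact0; exists (e x).
Qed.

Section Map.
Variables (F G : invsys P) (f : sysmor F G) (R : resolution F) (S : resolution G).
Variable phi : resmor f R S.

Lemma rep0_map t g : rep0 t g -> rep0 (syslim_map (phi 0%N) t) (fun x => f x (g x)).
Proof. by move=> tg x; rewrite syslim_mapE tg (rmor_aug phi). Qed.

Lemma rep1_map t g : rep1 t g -> rep1 (syslim_map (phi 1%N) t) (cochain1_map f g).
Proof.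
move=> [r [tr rg]]; exists (fun x => phi 0%N x (r x)); split=> [x|x y h].
  by rewrite syslim_mapE tr (rmor_d phi).
by rewrite -(rmor_aug phi) rg raddfB smor_nat.
Qed.
End Map.

(** Representation is a relation, compatible with differences, induced maps and pullbacks, so the
    canonical map can be followed without opening the resolutions. *)
Definition crep0 G (c : Rlim 0 G) (g : gprod G) :=
  exists2 z, c = quotpi _ z & rep0 (val z : syslim (the_resolution G 0)) g.

Definition crep1 G (c : Rlim 1 G) (g : cochain1 G) :=
  exists2 z, c = quotpi _ z & rep1 (val z : syslim (the_resolution G 1)) g.

Lemma crep0_ex G (c : Rlim 0 G) : exists2 g, thread_prop g & crep0 c g.
Proof.
pose z := repr (c : Quotient.quot _).
have [g gP zg] := rep0_ex (cocycleP z).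
by exists g => //; exists z => //; rewrite quotpi_reprK.
Qed.

Lemma crep1_ex G (c : Rlim 1 G) : exists2 g, cocycle1 g & crep1 c g.
Proof.
pose z := repr (c : Quotient.quot _).
have [g gP zg] := rep1_ex (cocycleP z).
by exists g => //; exists z => //; rewrite quotpi_reprK.
Qed.

Lemma crep0_onto G g : thread_prop g -> exists c : Rlim 0 G, crep0 c g.
Proof.
move=> /(rep0_onto (the_resolution G))[t dt tg].
have tz : (t : lim_complex (the_resolution G) 0) \in
  kerg (cxd (lim_complex (the_resolution G)) 0) by apply/kergP.
by exists (quotpi _ (sgproj tz)), (sgproj tz).
Qed.

Lemma crep1_onto G g : cocycle1 g -> exists c : Rlim 1 G, crep1 c g.
Proof.
have aR : acyc1 (the_resolution G 0).
  exact: (@acyc_injective _ _ 0 _ (@the_resolution_injective _ _ G 0)).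
move=> /(rep1_onto aR)[t dt tg].
have tz : (t : lim_complex (the_resolution G) 1) \in
  kerg (cxd (lim_complex (the_resolution G)) 1) by apply/kergP.
by exists (quotpi _ (sgproj tz)), (sgproj tz).
Qed.

Lemma crep0B G (c e : Rlim 0 G) f g : crep0 c f -> crep0 e g -> crep0 (c - e) (f - g).
Proof.
move=> [z -> zf] [w -> wg]; exists (z - w); first by rewrite raddfB.
set t : syslim _ := val z in zf *; set s : syslim _ := val w in wg *.
have -> : val (z - w) = t - s := raddfB (sgval _) z w.
exact: rep0B.
Qed.

Lemma crep1B G (c e : Rlim 1 G) f g : crep1 c f -> crep1 e g ->
  crep1 (c - e) (fun x y h => f x y h - g x y h).
Proof.
move=> [z -> zf] [w -> wg]; exists (z - w); first by rewrite raddfB.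
set t : syslim _ := val z in zf *; set s : syslim _ := val w in wg *.
have -> : val (z - w) = t - s := raddfB (sgval _) z w.
exact: rep1B.
Qed.

Lemma crep0_eq0 G (c : Rlim 0 G) g : crep0 c g -> c = 0 <-> forall x, g x = 0.
Proof.
move=> [z -> zg]; rewrite quotpi_eq0 mksubP; split=> [/= z0 x|g0].
  apply: (@rs_mono _ _ _ (the_resolution G)); rewrite -zg raddf0.
  exact: (congr1 (fun t : syslim (the_resolution G 0) => val t x) z0).
by apply: syslimP => x; rewrite zg g0 raddf0.
Qed.

Lemma crep1_eq0 G (c : Rlim 1 G) g : crep1 c g -> c = 0 <-> exists e, bounds g e.
Proof. by move=> [z -> zg]; rewrite quotpi_eq0 mksubP -(rep1_bounds zg). Qed.

Lemma crep0_ext G (c : Rlim 0 G) f g :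
  (forall x, f x = g x) -> crep0 c f -> crep0 c g.
Proof. by move=> fg [z cz zf]; exists z => // x; rewrite -fg. Qed.

Lemma crep1_ext G (c : Rlim 1 G) f g :
  (forall x y h, f x y h = g x y h) -> crep1 c f -> crep1 c g.
Proof.
move=> fg [z cz [r [zr rf]]]; exists z => //; exists r; split=> // x y h.
by rewrite -fg.
Qed.

Lemma crep0_0 G : crep0 (0 : Rlim 0 G) 0.
Proof.
exists 0 => [|x]; first by rewrite raddf0.
by rewrite gprod0 raddf0.
Qed.

Lemma crep1_0 G : crep1 (0 : Rlim 1 G) (fun x y h => 0).
Proof.
exists 0; first by rewrite raddf0.
exists (fun=> 0); split=> [x|x y h]; first by rewrite [RHS]raddf0.
by rewrite !raddf0 addr0.
Qed.

Lemma crep0_sum G (I : Type) (r : seq I) (c : I -> Rlim 0 G) g :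
  (forall i, crep0 (c i) (g i)) ->
  crep0 (\sum_(i <- r) c i) (fun x => \sum_(i <- r) g i x).
Proof.
move=> cg; elim: r => [|i r IH].
  by rewrite big_nil; apply: crep0_ext (crep0_0 G) => x; rewrite big_nil.
(* Representation is known to respect differences, so [c + S] is written as [c - (0 - S)]. *)
rewrite big_cons -[X in c i + X]opprK -[- (\sum_(j <- r) c j)]sub0r.
apply: crep0_ext (crep0B (cg i) (crep0B (crep0_0 G) IH)) => x.
by rewrite big_cons !gprodB gprod0 sub0r opprK.
Qed.

Lemma crep1_sum G (I : Type) (r : seq I) (c : I -> Rlim 1 G) g :
  (forall i, crep1 (c i) (g i)) ->
  crep1 (\sum_(i <- r) c i) (fun x y h => \sum_(i <- r) g i x y h).
Proof.
move=> cg; elim: r => [|i r IH].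
  by rewrite big_nil; apply: crep1_ext (crep1_0 G) => x y h; rewrite big_nil.
rewrite big_cons -[X in c i + X]opprK -[- (\sum_(j <- r) c j)]sub0r.
apply: crep1_ext (crep1B (cg i) (crep1B (crep1_0 G) IH)) => x y h.
by rewrite big_cons sub0r opprK.
Qed.

Lemma crep0_map F G (f : sysmor F G) c g :
  crep0 c g -> crep0 (Rlim_map 0 f c) (fun x => f x (g x)).
Proof.
move=> [z -> zg]; rewrite /Rlim_map cohomology_mapE; eexists; first by [].
exact: (rep0_map (comparison f _ _) zg).
Qed.

Lemma crep1_map F G (f : sysmor F G) c g :
  crep1 c g -> crep1 (Rlim_map 1 f c) (cochain1_map f g).
Proof.
move=> [z -> zg]; rewrite /Rlim_map cohomology_mapE; eexists; first by [].
exact: (rep1_map (comparison f _ _) zg).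
Qed.
End Representatives.

Section RepresentPullback.
Variables (d d' : Order.disp_t) (P : porderType d) (Q : porderType d').
Variables (e : P -> Q) (e_homo : {homo e : x y / (x <= y)%O}) (G : invsys Q).

Lemma Rlim_pullbackE n z :
  Rlim_pullback e_homo G n (quotpi _ z) =
  quotpi _ (cocycle_map (lim_cxmor (comparison (sysid (pullback e_homo G))
      (pullback_resolution e_homo (the_resolution G))
      (@the_resolution_injective _ _ (pullback e_homo G)))) n
    (cocycle_map (lim_pullback_cx e_homo (the_resolution G)) n z)).
Proof. by rewrite -2!cohomology_mapE. Qed.

Lemma crep0_pullback c g : crep0 c g ->
  crep0 (Rlim_pullback e_homo G 0 c) (fun x => g (e x)).
Proof.
move=> [z -> zg]; rewrite Rlim_pullbackE.
eexists; first by [].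
apply: (@rep0_map _ _ _ _ (sysid _) _ _ (comparison (sysid _) _ _)) => x.
exact: zg.
Qed.

Lemma crep1_pullback c g : crep1 c g ->
  crep1 (Rlim_pullback e_homo G 1 c) (fun x y h => g (e x) (e y) (e_homo h)).
Proof.
move=> [z -> [r [zr rg]]]; rewrite Rlim_pullbackE.
eexists; first by [].
pose R := the_resolution G.
have zg : @rep1 _ _ _ (pullback_resolution e_homo R) (lim_pullback e_homo (R 1) (val z))
    (fun x y h => g (e x) (e y) (e_homo h)).
  by exists (fun x => r (e x)); split=> [x|x y h]; [exact: zr|exact: rg].
exact: (rep1_map (comparison _ _ _) zg).
Qed.
End RepresentPullback.

(** * The canonical map *)

Section GsumPartial.
Variables (I : choiceType) (A : I -> zmodType).

Definition gsum_partial (r : seq I) (a : forall i, A i) : gsum A :=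
  \sum_(i <- r) gsum_in A i (a i).

Definition gsum_val i : {additive gsum A -> A i} :=
  mkadd (fun s t : gsum A => erefl (val (s - t) i)).

Lemma gsum_in_in i (a : A i) : val (gsum_in A i a) i = a.
Proof. exact: eqtype.dfwith_in. Qed.

Lemma gsum_in_out i j (a : A i) : i != j -> val (gsum_in A i a) j = 0.
Proof. by move=> ij; rewrite [LHS]eqtype.dfwith_out. Qed.

Lemma gsum_partialE r a i : uniq r ->
  val (gsum_partial r a) i = if i \in r then a i else 0.
Proof.
move=> ur; transitivity (gsum_val i (gsum_partial r a)); first by [].
rewrite raddf_sum; case: ifP => ir; last first.
  rewrite big_seq big1// => j jr; apply: gsum_in_out.
  by apply: contraFN ir => /eqP <-.
rewrite (bigD1_seq i)//= big1 ?addr0; first exact: gsum_in_in.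
by move=> j; exact: gsum_in_out.
Qed.

Lemma gsum_out_in (B : zmodType) (f : forall i, {additive A i -> B}) i a :
  gsum_out f (gsum_in A i a) = f i a.
Proof.
rewrite [LHS](@gsum_outE _ _ _ f _ [:: i])//; last first.
  move=> j; rewrite inE; have [->//|ij] := eqVneq j i.
  by rewrite gsum_in_out// eq_sym.
by rewrite big_seq1 gsum_in_in.
Qed.

Lemma gsum_out_partial (B : zmodType) (f : forall i, {additive A i -> B}) r a :
  gsum_out f (gsum_partial r a) = \sum_(i <- r) f i (a i).
Proof. by rewrite raddf_sum; apply: eq_bigr => i _; exact: gsum_out_in. Qed.

Lemma finite_support (a : gprod A) : finsupp_prop a ->
  exists2 r : seq I, uniq r & forall i, i \notin r -> a i = 0.
Proof.
move=> /finite_seqP[r ar]; exists (undup r) => [|i]; first exact: undup_uniq.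
rewrite mem_undup => ir; apply: contrapT => ai.
have : [set i | a i <> 0]%classic i by [].
by rewrite ar /= (negPf ir).
Qed.
End GsumPartial.

Section LimOmega.
Variables (kappa : choiceType) (T : Omega_system kappa).

Lemma omega_valB x (a b : omega_sys T x) alpha :
  val (a - b) alpha = val a alpha - val b alpha.
Proof. by []. Qed.

Lemma omega_bondE (x y : kappa -> nat) (h : (x <= y)%O) (a : omega_sys T y) alpha :
  val (bond (omega_sys T) h a) alpha = bond (T alpha) (omega_le h alpha) (val a alpha).
Proof. by []. Qed.

Lemma const_homo j k : (j <= k)%O -> (((fun=> j) : kappa -> nat) <= ((fun=> k) : kappa -> nat))%O.
Proof. by move=> h; apply/lefP => alpha. Qed.

(* The [alpha]-th component of a thread at [x] depends on [x alpha] only, and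
   infinitely many nonzero components would all be nonzero at a single [x]. *)
Lemma lim_omega (t : syslim (omega_sys T)) :
  exists (r : seq kappa) (tau : forall alpha, syslim (T alpha)),
    [/\ uniq r, forall alpha, alpha \notin r -> tau alpha = 0
      & forall x alpha, val (val t x) alpha = val (tau alpha) (x alpha)].
Proof.
have tb (x y : kappa -> nat) (h : (x <= y)%O) alpha (h' : (x alpha <= y alpha)%O) :
    bond (T alpha) h' (val (val t y) alpha) = val (val t x) alpha.
  rewrite -(syslim_thread t h) /=; congr (bond _ _ _); exact: bool_irrelevance.
have tauP alpha : thread_prop ((fun k => val (val t (fun=> k)) alpha) : gprod (T alpha)).
  by move=> j k h; exact: (tb _ _ (const_homo h)).
pose tau alpha := mkthread (tauP alpha).
have tE x alpha : val (val t x) alpha = val (tau alpha) (x alpha).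
  (* [y] dominates [x] and the constant function [x alpha]; both values at [alpha] are images of the
     value at [y] under the same bonding map. *)
  pose y beta := maxn (x beta) (x alpha).
  have xy : (x <= y)%O by apply/lefP => beta; rewrite leEnat leq_maxl.
  have cy : (((fun=> x alpha) : kappa -> nat) <= y)%O by apply/lefP => beta; rewrite leEnat leq_maxr.
  have h := omega_le xy alpha.
  by rewrite -(tb _ _ xy _ h); exact: (tb _ _ cy _ h).
have tau_fin : finsupp_prop (tau : gprod (fun alpha => syslim (T alpha))).
  have /dep_choice[x xP] alpha : exists k, tau alpha <> 0 -> val (tau alpha) k <> 0.
    apply: contrapT => nk; have tau0 : tau alpha = 0.
      apply: syslimP => k; apply: contrapT => tk; apply: nk; by exists k.
    by apply: nk; exists 0%N.
  apply: sub_finite_set (gsum_finite (val t x)) => alpha /= /xP.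
  by rewrite tE.
by have [r ur r0] := finite_support tau_fin; exists r, tau.
Qed.
End LimOmega.

Section Canonical.
Variables (kappa : choiceType) (G : Omega_system kappa).

Definition canonical_component n alpha : {additive Rlim n (G alpha) -> Rlim n (omega_sys G)} :=
  Rlim_map n (omega_in G alpha) \o Rlim_pullback (ev_homo alpha) (G alpha) n.

Lemma canonical_partial n r (c : forall alpha, Rlim n (G alpha)) :
  canonical_map G n (gsum_partial r c) = \sum_(alpha <- r) canonical_component n alpha (c alpha).
Proof. exact: gsum_out_partial. Qed.

Lemma canonical_support n (s : gsum (fun alpha => Rlim n (G alpha))) :
  exists2 r, uniq r & (forall alpha, alpha \notin r -> val s alpha = 0) /\
    canonical_map G n s = \sum_(alpha <- r) canonical_component n alpha (val s alpha).
Proof.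
have [r ur sr] := finite_support (gsum_finite s); exists r => //; split=> //.
rewrite -canonical_partial; congr (canonical_map G n _); apply: gsumP => alpha.
by rewrite gsum_partialE//; case: ifPn => // /sr.
Qed.

Lemma canonical_bijective n :
  (forall s, canonical_map G n s = 0 -> s = 0) ->
  (forall c, exists s, c = canonical_map G n s) -> bijective (canonical_map G n).
Proof.
move=> inj0 sur; have inj := raddf_inj inj0.
have [f fK] := dep_choice sur.
by exists f => [s|c]; [apply: inj; rewrite -fK|rewrite -fK].
Qed.

Section Degree0.

Lemma crep0_canonical r (c : forall alpha, Rlim 0 (G alpha)) g :
  (forall alpha, crep0 (c alpha) (g alpha)) ->
  crep0 (\sum_(alpha <- r) canonical_component 0 alpha (c alpha))
    (fun x => gsum_partial r (fun alpha => g alpha (x alpha))).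
Proof.
move=> cg; exact: (crep0_sum r (fun alpha => crep0_map (omega_in G alpha)
  (crep0_pullback (ev_homo alpha) (cg alpha)))).
Qed.

(** Injectivity evaluates a thread at constant functions; for surjectivity [lim_omega] splits a
    thread into finitely many threads of the towers. *)
Lemma canonical_bijective0 : bijective (canonical_map G 0).
Proof.
apply: canonical_bijective => [s|c].
  have [r ur [sr ->]] := canonical_support s.
  have /dep_choice[g gs] alpha : exists g, crep0 (val s alpha) g.
    by have [g _] := crep0_ex (val s alpha); exists g.
  move=> /(crep0_eq0 (crep0_canonical r gs)) g0.
  apply: gsumP => alpha; have [ar|/sr//] := boolP (alpha \in r).
  apply/(crep0_eq0 (gs alpha)) => k.
  have := congr1 (fun a => val a alpha) (g0 (fun=> k)).
  by rewrite gsum_partialE// ar.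
have [gam gP cg] := crep0_ex c.
have [r [tau [ur tau0 tauE]]] := lim_omega (mkthread gP).
have /dep_choice[e etau] alpha : exists e : Rlim 0 (G alpha), crep0 e (val (tau alpha)).
  exact/crep0_onto/syslim_thread.
exists (gsum_partial r e); rewrite canonical_partial.
apply/eqP; rewrite -subr_eq0; apply/eqP.
apply/(crep0_eq0 (crep0B cg (crep0_canonical r etau))) => x.
rewrite gprodB; apply/eqP; rewrite subr_eq0; apply/eqP/gsumP => alpha.
rewrite gsum_partialE// [LHS]tauE; case: ifPn => // /tau0 ->.
by [].
Qed.
End Degree0.

Section Degree1.

Lemma crep1_canonical r (c : forall alpha, Rlim 1 (G alpha)) g :
  (forall alpha, crep1 (c alpha) (g alpha)) ->
  crep1 (\sum_(alpha <- r) canonical_component 1 alpha (c alpha))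
    (fun x y h => gsum_partial r (fun alpha => g alpha _ _ (ev_homo alpha h))).
Proof.
move=> cg; exact: (crep1_sum r (fun alpha => crep1_map (omega_in G alpha)
  (crep1_pullback (ev_homo alpha) (cg alpha)))).
Qed.

(** For injectivity, a bounding cochain is restricted to constant functions. For surjectivity, a
    class bounded in the coinduced sum comes from a thread of cosyzygies, which [lim_omega] splits
    into threads of single towers; their connecting maps give the preimage. *)
Lemma canonical_bijective1 : acyc1 (omega_sys (omega_coind G)) ->
  bijective (canonical_map G 1).
Proof.
move=> aC; apply: canonical_bijective => [s|c].
  have [r ur [sr ->]] := canonical_support s.
  have /dep_choice[g gs] alpha : exists g, crep1 (val s alpha) g.
    by have [g _] := crep1_ex (val s alpha); exists g.
  move=> /(crep1_eq0 (crep1_canonical r gs))[e ge].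
  apply: gsumP => alpha; have [ar|/sr//] := boolP (alpha \in r).
  apply/(crep1_eq0 (gs alpha)); exists (fun k => val (e (fun=> k)) alpha) => j k h.
  have := congr1 (fun a => val a alpha) (ge _ _ (const_homo kappa h)).
  rewrite gsum_partialE// ar => E.
  rewrite (bool_irrelevance h (ev_homo alpha (const_homo kappa h))) E gsumB /=.
  by congr (bond _ _ _ - _); exact: bool_irrelevance.
have [gam gamC cgam] := crep1_ex c.
have [e ge] := aC _ (cocycle1_map (omega_to_coind G) gamC).
have eip := omega_cosyz_exact G; have [mi ep sp] := eip.
have tP : thread_prop ((fun x => omega_to_cosyz G x (e x)) : gprod (omega_sys (omega_cosyz G))).
  move=> x y h; rewrite -smor_nat; apply/eqP; rewrite -subr_eq0 -raddfB -ge.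
  by apply/eqP/ep; exists (gam x y h).
have [r [tau [ur tau0 tauE]]] := lim_omega (mkthread tP).
have /dep_choice[eps epsE] alpha : exists eps : forall k, coind (G alpha) k,
    forall k, val (tau alpha) k = to_coker (to_coind (G alpha)) k (eps k).
  exact: (dep_choice (fun k => to_coker_surj (val (tau alpha) k))).
(* The connecting map of one tower: the coboundary of the lift [eps alpha] of [tau alpha] has values
   in [G alpha]. *)
have /dep_choice[g gP] alpha : exists g, cocycle1 g /\
    bounds (cochain1_map (to_coind (G alpha)) g) (eps alpha).
  have [|j k h|g cg gE] := @lift_cocycle1 _ _ _ _ _ _ _ (cosyz_exact (G alpha))
    (fun j k h => bond (coind (G alpha)) h (eps alpha k) - eps alpha j).
  - exact: (@bounds_cocycle _ _ _ _ (eps alpha)).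
  - by rewrite raddfB smor_nat -!epsE syslim_thread subrr.
  by exists g; split=> // j k h; rewrite /cochain1_map -gE.
have /dep_choice[a ag] alpha : exists a : Rlim 1 (G alpha), crep1 a (g alpha).
  by apply: crep1_onto; exact: (gP alpha).1.
exists (gsum_partial r a); rewrite canonical_partial.
apply/eqP; rewrite eq_sym -subr_eq0; apply/eqP.
apply/(crep1_eq0 (crep1B (crep1_canonical r ag) cgam)).
(* Both terms have the same image in the cosyzygies, so [E] comes from a 0-cochain of [omega_sys G],
   which bounds the difference of the two cocycles. *)
pose E x : omega_sys (omega_coind G) x :=
  gsum_partial r (fun alpha => eps alpha (x alpha)) - e x.
have /dep_choice[h hE] x : exists h, E x = omega_to_coind G x h.
  apply/ep; apply: gsumP => alpha; rewrite omega_mapE gsumB raddfB gsum_partialE//.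
  have -> : to_coker (to_coind (G alpha)) (x alpha) (val (e x) alpha) =
    val (tau alpha) (x alpha) := tauE x alpha.
  case: ifPn => [_|/tau0 ->]; first by rewrite epsE subrr.
  by rewrite raddf0 subr0.
exists h => x y le_xy; apply: mi.
have gexy : omega_to_coind G x (gam x y le_xy) = _ := ge x y le_xy.
rewrite [LHS]raddfB [RHS]raddfB smor_nat -!hE gexy; apply: gsumP => alpha.
rewrite !omega_valB omega_mapE !omega_bondE !omega_valB (raddfB (bond _ _)) !gsum_partialE//.
case: ifPn => _; last by rewrite !raddf0 !sub0r opprB addrC opprK.
rewrite [X in X - _ = _]((gP alpha).2 _ _ (ev_homo alpha le_xy)).
rewrite subrACA; congr (_ - _ - _); rewrite /=.
by rewrite (bool_irrelevance (ev_homo alpha le_xy) (omega_le le_xy alpha)).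
Qed.
End Degree1.
End Canonical.

Theorem theorem3p1 (kappa : choiceType) (n : nat)
  (lim_A_eq0 : forall s : nat, (1 <= s <= n.+1)%N ->
     forall c : Rlim s (omega_sys (A_system kappa)), c = 0)
  (G : Omega_system kappa)
  (G_fin_gen : forall (alpha : kappa) (k : nat), fin_gen (G alpha k)) :
  bijective (canonical_map G n).
Proof.
(* The shifted indexing of [acyc] turns degrees 1 to [n + 1] into [s <= n]. *)
have acycA s : (s <= n)%N -> acyc s (omega_sys (A_system kappa)).
  by move=> sn; apply: (@Rlim_eq0 _ _ s _).1; exact: lim_A_eq0.
case: n acycA {lim_A_eq0} => [_|[acycA|n acycA]]; first exact: canonical_bijective0.
  by apply: canonical_bijective1; exact: (acyc_omega_coind acycA G_fin_gen (s := 0)).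
(* From degree 2 on, source and target both vanish, so the zero map is an inverse. *)
have lim0 : forall c : Rlim n.+2 (omega_sys G), c = 0.
  exact: (@Rlim_eq0 _ _ n.+1 _).2 (acycS_omega acycA G_fin_gen _).
have tower0 alpha : forall c : Rlim n.+2 (G alpha), c = 0.
  exact: (@Rlim_eq0 _ _ n.+1 _).2 (acycS_tower n _).
exists (fun=> 0) => [s|c]; last exact: etrans (lim0 _) (esym (lim0 _)).
by apply: gsumP => alpha; exact: etrans (tower0 _ _) (esym (tower0 _ _)).
Qed.
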